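(* Let $\ell\ge -1$ be an integer and let $\mathcal{E}\cong\mathcal{O}_{\mathbb{P}^1}(a_1)\oplus\cdots\oplus\mathcal{O}_{\mathbb{P}^1}(a_r)$ be a vector bundle of rank $r\ge 2$ on $\mathbb{P}^1$ with $a_1\ge\cdots\ge a_r$. (i) If $(\mathcal{E},\Phi)$ is semistable with a map $\Phi:\mathcal{E}\to\mathcal{E}(2+\ell)$, then $a_{i+1}\ge a_i-\ell-2$ for each $i\le r-1$. (ii) Conversely, if $a_{i+1}\ge a_i-\ell-2$ for each $i\le r-1$, then there is a map $\Phi:\mathcal{E}\to\mathcal{E}(2+\ell)$ such that no proper subbundle $\mathcal{F}\subset\mathcal{E}$ satisfies $\Phi(\mathcal{F})\subseteq\mathcal{F}(2+\ell)$, and in particular $(\mathcal{E},\Phi)$ is stable. The set of all such $\Phi$ is a non-empty open subset of the vector space $H^0(\mathcal{E}nd(\mathcal{E})(2+\ell))$.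
   Context: $\mathbb{P}^1$ is the complex projective line, and $\mathcal{E}(t)=\mathcal{E}\otimes\mathcal{O}_{\mathbb{P}^1}(t)$. A pair $(\mathcal{E},\Phi)$ with $\Phi:\mathcal{E}\to\mathcal{E}(2+\ell)$ a morphism is semistable (resp. stable) if $\mu(\mathcal{F})\le\mu(\mathcal{E})$ (resp. $<$) for every coherent subsheaf $0\subsetneq\mathcal{F}\subsetneq\mathcal{E}$ with $\Phi(\mathcal{F})\subset\mathcal{F}(2+\ell)$, where $\mu(\mathcal{F})=\deg(\mathcal{F})/\mathrm{rank}(\mathcal{F})$. A proper subbundle is a subbundle $\mathcal{F}$ with $0\subsetneq\mathcal{F}\subsetneq\mathcal{E}$. *)

(* Defs.v *)
From HB Require Import structures.
From mathcomp Require Import all_boot all_order all_algebra.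
From mathcomp Require Import boolp classical_sets.

Set Implicit Arguments.
Unset Strict Implicit.
Unset Printing Implicit Defensive.
Import GRing.Theory Num.Theory.
Local Open Scope ring_scope.

(* The projective line over a field k is covered by the affine lines
   U0 = Spec k[z] and U1 = Spec k[w], glued by w = 1/z along
   Spec k[z, 1/z].  A quasi-coherent sheaf is a k[z]-module and a k[w]-module
   with an isomorphism of their localisations over k[z, 1/z]; all gluing is
   carried out inside the function field k(z). *)

Section ProjectiveLine.
Variable k : fieldType.

Local Notation Kz := {fraction {poly k}}.
Definition zz : Kz := tofrac 'X.

(* Both charts use {poly k} as coordinate ring: on U0 the indeterminate is z,
   on U1 it is w = 1/z. *)
Definition res0 : {poly k} -> Kz := @tofrac {poly k}.
HB.instance Definition _ := GRing.RMorphism.copy res0 (@tofrac {poly k}).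

Definition res1 : {poly k} -> Kz :=
  horner_eval zz^-1 \o map_poly (@tofrac {poly k} \o @polyC k).
HB.instance Definition _ := GRing.RMorphism.copy res1
  (horner_eval zz^-1 \o map_poly (@tofrac {poly k} \o @polyC k)).

Definition laurent (f : Kz) : Prop := exists p n, f = res0 p / zz ^+ n.
Definition laurent_mx m n (A : 'M[Kz]_(m, n)) : Prop :=
  forall i j, laurent (A i j).

Lemma laurentM f g : laurent f -> laurent g -> laurent (f * g).
Proof.
case=> p [m ->] [q [n ->]]; exists (p * q), (m + n)%N.
by rewrite rmorphM exprD invfM mulrACA.
Qed.

Lemma laurent_zz (d : int) : laurent (zz ^ d).
Proof.
case: d => n; first by exists 'X^n, 0%N; rewrite rmorphXn expr0 divr1.
by exists 1, n.+1; rewrite rmorph1 mul1r.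
Qed.

Lemma laurent0 : laurent 0.
Proof. by exists 0, 0%N; rewrite rmorph0 mul0r. Qed.

Lemma zz_neq0 : zz != 0.
Proof. by rewrite tofrac_eq0 polyX_eq0. Qed.

(* A rank r vector bundle: it is trivial on both affine lines (k[z] is
   principal), so it is given by a transition matrix in GL_r(k[z, 1/z]).
   Sections v0 on U0 and v1 on U1 agree on the overlap when v1 = G v0. *)
Record bundle (r : nat) := Bundle {
  cocycle :> 'M[Kz]_r;
  cocycle_unit : cocycle \in unitmx;
  cocycle_laurent : laurent_mx cocycle;
  cocycle_inv_laurent : laurent_mx (invmx cocycle) }.

(* The degree is that of the determinant line bundle, whose transition
   function is a unit c z^-d of k[z, 1/z]; O(d) has transition function z^-d,
   its sections on P^1 being the polynomials of degree at most d in z. *)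
Definition degree r (E : bundle r) : int :=
  xget 0 [set d : int | exists2 c : k, c != 0 &
    \det E = res0 c%:P * zz ^ (- d)].

Definition slope r (E : bundle r) : rat := (degree E)%:~R / r%:R.

Definition split_mx r (a : 'I_r -> int) : 'M[Kz]_r :=
  diag_mx (\row_i zz ^ (- a i)).

Lemma split_mxV r (a : 'I_r -> int) :
  split_mx a *m split_mx (fun i => - a i) = 1%:M.
Proof.
rewrite /split_mx mulmx_diag -diag_const_mx; congr diag_mx.
apply/rowP=> i; rewrite !mxE -expfzDr ?zz_neq0 // opprK addNr.
by rewrite expr0z.
Qed.

Lemma split_unit r (a : 'I_r -> int) : split_mx a \in unitmx.
Proof. exact: (proj1 (mulmx1_unit (split_mxV a))). Qed.

Lemma split_laurent r (a : 'I_r -> int) : laurent_mx (split_mx a).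
Proof.
move=> i j; rewrite !mxE; case: eqP => _; last exact: laurent0.
exact: laurent_zz.
Qed.

Lemma split_inv_laurent r (a : 'I_r -> int) : laurent_mx (invmx (split_mx a)).
Proof.
rewrite -[invmx _]mulmx1 -(split_mxV a) mulKmx ?split_unit //.
exact: split_laurent.
Qed.

(* O(a_1) (+) ... (+) O(a_r) *)
Definition split_bundle r (a : 'I_r -> int) : bundle r :=
  Bundle (split_unit a) (@split_laurent _ a) (@split_inv_laurent _ a).

Section Twist.
Variables (t : int) (r : nat) (E : bundle r).

Lemma twist_unit : zz ^ (- t) *: (E : 'M_r) \in unitmx.
Proof.
by rewrite unitmxZ ?cocycle_unit // unitfE expfz_neq0 ?zz_neq0.
Qed.

Lemma twist_laurent : laurent_mx (zz ^ (- t) *: (E : 'M_r)).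
Proof.
move=> i j; rewrite mxE; apply: laurentM; first exact: laurent_zz.
exact: cocycle_laurent.
Qed.

Lemma twist_inv_laurent : laurent_mx (invmx (zz ^ (- t) *: (E : 'M_r))).
Proof.
move=> i j; rewrite invmxZ ?twist_unit // mxE invr_expz opprK.
by apply: laurentM; [exact: laurent_zz | exact: cocycle_inv_laurent].
Qed.

(* E(t) = E (x) O(t) *)
Definition twist : bundle r :=
  Bundle twist_unit twist_laurent twist_inv_laurent.
End Twist.

(* Morphisms of vector bundles: a matrix on each chart, compatible with the
   transition matrices. *)
Section Hom.
Variables (r s : nat) (E : bundle r) (E' : bundle s).

Definition hom_compat : pred ('M[{poly k}]_(s, r) * 'M[{poly k}]_(s, r)) :=
  fun A => map_mx res1 A.2 *m E == E' *m map_mx res0 A.1.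

Record bundle_hom := Hom {
  hom_pair : 'M[{poly k}]_(s, r) * 'M[{poly k}]_(s, r);
  hom_pairP : hom_compat hom_pair }.

Definition hom0 (f : bundle_hom) : 'M[{poly k}]_(s, r) := (hom_pair f).1.
Definition hom1 (f : bundle_hom) : 'M[{poly k}]_(s, r) := (hom_pair f).2.

HB.instance Definition _ := [isSub for hom_pair].
HB.instance Definition _ := [Choice of bundle_hom by <:].

Fact hom_compat_zmod_closed : zmod_closed hom_compat.
Proof.
split=> [|A B]; rewrite !unfold_in /hom_compat /=.
  by rewrite !map_mx0 mul0mx mulmx0.
by move=> /eqP eA /eqP eB; rewrite !map_mxB mulmxBl mulmxBr eA eB.
Qed.
HB.instance Definition _ :=
  GRing.isZmodClosed.Build _ hom_compat hom_compat_zmod_closed.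
HB.instance Definition _ := [SubChoice_isSubZmodule of bundle_hom by <:].

Fact hom_scale_subproof (c : k) (f : bundle_hom) :
  hom_compat (c%:P *: hom0 f, c%:P *: hom1 f).
Proof.
rewrite /hom_compat /= !map_mxZ /= -scalemxAl -scalemxAr.
have -> : res1 c%:P = res0 c%:P.
  by rewrite /res1 /= map_polyC /= /horner_eval hornerC.
by apply/eqP; congr (_ *: _); apply/eqP/(hom_pairP f).
Qed.

Definition hom_scale (c : k) (f : bundle_hom) : bundle_hom :=
  Hom (hom_scale_subproof c f).

Fact hom_scaleA c d f : hom_scale c (hom_scale d f) = hom_scale (c * d) f.
Proof.
by apply: val_inj; rewrite /= /hom0 /hom1 /= !scalerA polyCM.
Qed.
Fact hom_scale1 : left_id 1 hom_scale.
Proof.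
by move=> f; apply: val_inj; rewrite /= !scale1r [RHS]surjective_pairing.
Qed.
Fact hom_scaleDr : right_distributive hom_scale +%R.
Proof. by move=> c f g; apply: val_inj; rewrite /= /hom0 /hom1 /= !scalerDr. Qed.
Fact hom_scaleDl f : {morph hom_scale^~ f : c d / c + d}.
Proof.
by move=> c d; apply: val_inj; rewrite /= /hom0 /hom1 /= polyCD !scalerDl.
Qed.
(* The k-vector space Hom(E, E'). *)
HB.instance Definition _ := GRing.Zmodule_isLmodule.Build k bundle_hom
  hom_scaleA hom_scale1 hom_scaleDr hom_scaleDl.
End Hom.

Definition bundle_iso r s (E : bundle r) (E' : bundle s) : Prop :=
  exists (f : bundle_hom E E') (g : bundle_hom E' E),
    [/\ hom0 g *m hom0 f = 1%:M, hom1 g *m hom1 f = 1%:M,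
        hom0 f *m hom0 g = 1%:M & hom1 f *m hom1 g = 1%:M].

(* Localisations, over the overlap, of a subset of the free module on U0,
   resp. U1, as subsets of k(z)^r. *)
Definition loc0 r (F0 : set 'cV[{poly k}]_r) : set 'cV[Kz]_r :=
  [set u | exists n v, F0 v /\ u = zz ^- n *: map_mx res0 v].
Definition loc1 r (F1 : set 'cV[{poly k}]_r) : set 'cV[Kz]_r :=
  [set u | exists n v, F1 v /\ u = zz ^+ n *: map_mx res1 v].

Definition submodule r (M : set 'cV[{poly k}]_r) : Prop :=
  M 0 /\ forall (p : {poly k}) u v, M u -> M v -> M (p *: u + v).

(* Coherent subsheaves of E: a submodule of the sections on each chart, with
   the same localisation on the overlap.  Finite generation is automatic,
   {poly k} being noetherian. *)
Record subsheaf r (E : bundle r) := Subsheaf {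
  sub0 : set 'cV[{poly k}]_r;
  sub1 : set 'cV[{poly k}]_r;
  sub0P : submodule sub0;
  sub1P : submodule sub1;
  sub_glue : forall u, loc0 sub0 u <-> loc1 sub1 (E *m u) }.

Section Subsheaf.
Variables (r : nat) (E : bundle r).
Implicit Type F : subsheaf E.

Definition sub_zero F : Prop :=
  (sub0 F `<=` [set 0])%classic /\ (sub1 F `<=` [set 0])%classic.
Definition sub_full F : Prop :=
  (forall v, sub0 F v) /\ (forall v, sub1 F v).
Definition sub_proper F : Prop := ~ sub_zero F /\ ~ sub_full F.

(* N is isomorphic to F: an injective morphism from N to E has image F. *)
Definition sub_iso s (N : bundle s) F : Prop :=
  exists j : bundle_hom N E,
    [/\ injective (fun u : 'cV_s => hom0 j *m u),
        injective (fun u : 'cV_s => hom1 j *m u),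
        sub0 F = range (fun u : 'cV_s => hom0 j *m u) &
        sub1 F = range (fun u : 'cV_s => hom1 j *m u)].

(* Coherent subsheaves of vector bundles on a smooth curve are locally free,
   so the sets below are singletons. *)
Definition sub_rank F : nat :=
  xget 0%N [set s : nat | exists N : bundle s, sub_iso N F].
Definition sub_degree F : int :=
  xget 0 [set d : int | exists s (N : bundle s), sub_iso N F /\ degree N = d].

Definition sub_slope F : rat := (sub_degree F)%:~R / (sub_rank F)%:R.

Definition direct_summand (M : set 'cV[{poly k}]_r) : Prop :=
  exists M' : set 'cV[{poly k}]_r,
    [/\ submodule M', (M `&` M' `<=` [set 0])%classic &
        forall v, exists u u', [/\ M u, M' u' & v = u + u']].

(* E/F is locally free: over an affine line this means that the
   submodule of sections of F has a complement. *)
Definition subbundle F : Prop :=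
  direct_summand (sub0 F) /\ direct_summand (sub1 F).

Variable t : int.

(* The subsheaf F(t) of E(t) has the same submodules as F on the charts. *)
Fact sub_twist_glue F u :
  loc0 (sub0 F) u <-> loc1 (sub1 F) (twist t E *m u).
Proof.
have closed (d : int) v : loc1 (sub1 F) v -> loc1 (sub1 F) (zz ^ d *: v).
  move=> [n [v1 [Fv1 ->]]].
  case: d => m.
    exists (m + n)%N, v1; split=> //.
    by rewrite scalerA exprD.
  exists n, ('X^(m.+1) *: v1); split.
    have [F0 Flin] := sub1P F; rewrite -[_ *: _]addr0; exact: Flin.
  rewrite map_mxZ /= !scalerA mulrC; congr (_ * _ *: _).
  rewrite rmorphXn /= /res1 /= map_polyX /horner_eval hornerX NegzE.
  by rewrite -exprnN exprVn.
rewrite sub_glue /= -scalemxAl; split; first exact: closed.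
move=> /(closed t); rewrite scalerA -expfzDr ?zz_neq0 // addrN expr0z.
by rewrite scale1r.
Qed.
Definition sub_twist F : subsheaf (twist t E) :=
  @Subsheaf _ (twist t E) _ _ (sub0P F) (sub1P F) (@sub_twist_glue F).

Definition maps_into (Phi : bundle_hom E (twist t E)) F (F' : subsheaf (twist t E)) :
    Prop :=
  (forall v, sub0 F v -> sub0 F' (hom0 Phi *m v)) /\
  (forall v, sub1 F v -> sub1 F' (hom1 Phi *m v)).

Definition preserved (Phi : bundle_hom E (twist t E)) F : Prop :=
  maps_into Phi F (sub_twist F).

Definition semistable (Phi : bundle_hom E (twist t E)) : Prop :=
  forall F, sub_proper F -> preserved Phi F -> sub_slope F <= slope E.

Definition stable (Phi : bundle_hom E (twist t E)) : Prop :=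
  forall F, sub_proper F -> preserved Phi F -> sub_slope F < slope E.

Definition no_invariant_subbundle (Phi : bundle_hom E (twist t E)) : Prop :=
  forall F, subbundle F -> sub_proper F -> ~ preserved Phi F.

End Subsheaf.

Section Zariski.
Variable V : lmodType k.

Inductive polynomial_function : (V -> k) -> Prop :=
| PolyCst (c : k) : polynomial_function (fun=> c)
| PolyLin (f : {linear V -> k^o}) : polynomial_function f
| PolyAdd f g : polynomial_function f -> polynomial_function g ->
    polynomial_function (fun v => f v + g v)
| PolyMul f g : polynomial_function f -> polynomial_function g ->
    polynomial_function (fun v => f v * g v).

Definition zariski_closed (Z : set V) : Prop :=
  exists2 I : set (V -> k), (I `<=` polynomial_function)%classic &
    Z = [set v | forall f, I f -> f v = 0]%classic.

Definition zariski_open (U : set V) : Prop := zariski_closed (~` U)%classic.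
End Zariski.

End ProjectiveLine.

(* Main.v *)
(* (i) If a_(i+1) < a_i - (l + 2), the matrix of Phi in the splitting of E is
   block triangular, so O(a_1) + ... + O(a_i) is invariant; its slope exceeds
   that of E.

   (ii) Invariant subbundles correspond to Phi-invariant subspaces of the
   generic fibre k(z)^r.  Take for Phi the companion matrix of X^r - z.  If C is
   its restriction to an invariant submodule of rank s, then C^r = z gives
   det(C)^r = z^s, so r divides s.  When no subbundle is invariant, every proper
   invariant subsheaf has full rank, hence smaller degree: compare determinants.

   Openness: some invariant subbundle has rank s iff there is a monic b of degree
   s over k[z] such that b(Phi) is singular; one can take for b the
   characteristic polynomial of the restriction, whose coefficients have degree
   at most N = r (l + 2).  By Lagrange interpolation, b is determined by its
   values at z = 0, ..., N, hence by s of the eigenvalues of Phi at each of these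
   points.  Thus the condition is: det b(Phi) = 0 in k[z] for some choice of
   eigenvalues.  An eigenvalue mu of a matrix M is eliminated from an equation
   D(mu) = 0 by replacing it with det D(M) = 0, so the condition amounts to the
   vanishing of coefficients that are polynomial in Phi. *)
Require Import Defs.
From HB Require Import structures.
From mathcomp Require Import all_boot all_order all_algebra.
From mathcomp Require Import boolp classical_sets reals.
From mathcomp.real_closed Require Import complex.
From mathcomp Require Import generic_quotient zify ring.

Set Implicit Arguments.
Unset Strict Implicit.
Unset Printing Implicit Defensive.
Import Order.TTheory GRing.Theory Num.Theory.
Local Open Scope ring_scope.

(** * The two charts *)

Section Charts.
Variable k : fieldType.
Local Notation Kz := {fraction {poly k}}.
Local Notation zz := (zz k).
Local Notation res0 := (@res0 k).
Local Notation res1 := (@res1 k).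
Local Notation laurent := (@laurent k).
Local Notation zz_neq0 := (zz_neq0 k).

Lemma res0_inj : injective res0.
Proof. by move=> p q /eqP; rewrite tofrac_eq => /eqP. Qed.

Lemma res0X : res0 'X = zz. Proof. by []. Qed.

Lemma res1X : res1 'X = zz^-1.
Proof. by rewrite /Defs.res1 /= map_polyX /horner_eval hornerX. Qed.

Lemma res1C (c : k) : res1 c%:P = res0 c%:P.
Proof. by rewrite /Defs.res1 /= map_polyC /= /horner_eval hornerC. Qed.

(** This is z^n p(1/z) when p has degree at most n: the passage from one coordinate to the other. *)
Definition revp n (p : {poly k}) : {poly k} := \poly_(i < n.+1) p`_(n - i).

Lemma revpK n (p : {poly k}) : (size p <= n.+1)%N -> revp n (revp n p) = p.
Proof.
move=> sp; apply/polyP => i; rewrite /revp !coef_poly ltnS.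
case: (leqP i n) => [le_in | lt_ni]; last by rewrite nth_default ?(leq_trans sp).
by rewrite ltnS leq_subr subKn.
Qed.

Lemma res1_rev n (p : {poly k}) : (size p <= n.+1)%N ->
  zz ^+ n * res1 p = res0 (revp n p).
Proof.
move=> sp; have ep : p = \sum_(i < n.+1) p`_i *: 'X^i.
  rewrite -(poly_def _ (fun i => p`_i)); apply/polyP => i; rewrite coef_poly.
  by case: ltnP => // lt_ni; rewrite nth_default ?(leq_trans sp).
rewrite {1}ep /revp poly_def !rmorph_sum mulr_sumr /= [RHS](reindex_inj rev_ord_inj) /=.
apply: eq_bigr => i _; rewrite -!mul_polyC !rmorphM !rmorphXn /= res1X res1C.
have lt_in := ltn_ord i.
rewrite subSS subKn // mulrCA; congr (_ * _).
rewrite exprVn -[X in zz ^+ X](subnK (lt_in : (i <= n)%N)).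
by rewrite exprD mulfK ?expf_neq0 ?zz_neq0.
Qed.

Lemma res1_inj : injective res1.
Proof.
move=> p q epq; pose n := maxn (size p) (size q).
have sp : (size p <= n.+1)%N by rewrite leqW ?leq_maxl.
have sq : (size q <= n.+1)%N by rewrite leqW ?leq_maxr.
rewrite -(revpK sp) -(revpK sq); congr revp; apply: res0_inj.
by rewrite -!res1_rev ?epq.
Qed.

(* Sections of O(d) are the polynomials of degree at most d. *)
Lemma section_degree (d : int) (p q : {poly k}) :
  res1 q = zz ^ (- d) * res0 p -> p != 0 -> (size p).-1%:Z <= d.
Proof.
move=> e p0; have e1 : zz ^ d * res0 (revp (size q) q) = zz ^+ size q * res0 p.
  rewrite -(res1_rev (leqnSn _)) e mulrCA; congr (_ * _).
  by rewrite mulrA -expfzDr ?zz_neq0 // addrN expr0z mul1r.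
have := size_poly (size q).+1 (fun i => q`_(size q - i)).
rewrite -/(revp _ _); set p' := revp _ _ in e1 * => sr.
have p'0 : p' != 0.
  apply: contraNneq p0 => p'0; move: e1; rewrite p'0 rmorph0 mulr0 => /esym/eqP.
  by rewrite mulf_eq0 expf_eq0 (negPf zz_neq0) andbF tofrac_eq0.
have sp : (0 < size p)%N by rewrite size_poly_gt0.
case: d {e} e1 => d e1.
  move: e1; rewrite -!res0X -!exprnP -!rmorphXn -!rmorphM => /res0_inj.
  move=> /(congr1 (fun x : {poly k} => size x)).
  rewrite /= ['X^_ * p']mulrC ['X^_ * p]mulrC !size_mulXn // lez_nat => e.
  have aux a b c : (d + a = b + c -> a <= b.+1 -> c.-1 <= d)%N by lia.
  exact: aux e sr.
(* [Negz d] is -(d + 1); comparing sizes then forces [size p = 0], a contradiction. *)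
move: e1; rewrite NegzE -exprnN mulrC => /(congr1 (fun x => x * zz ^+ d.+1)).
rewrite mulfVK ?expf_neq0 ?zz_neq0 // mulrAC -exprD.
rewrite -!res0X -!rmorphXn -!rmorphM => /res0_inj.
move=> /(congr1 (fun x : {poly k} => size x)).
rewrite /= ['X^_ * p]mulrC !size_mulXn // => e.
have aux a b c : (a = b + d.+1 + c -> a <= b.+1 -> c <= 0)%N by lia.
by have := aux _ _ _ e sr; rewrite leqNgt sp.
Qed.

(** Reversal gives the section on the other chart. Bounding [size p] instead of the degree admits p
    = 0 when d = -1. *)
Lemma section_lift (d : int) (p : {poly k}) : (size p)%:Z <= d + 1 ->
  exists q, res1 q = zz ^ (- d) * res0 p.
Proof.
case: d => d h; last first.
  have -> : p = 0 by apply/eqP; rewrite -size_poly_eq0; lia.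
  by exists 0; rewrite !rmorph0 mulr0.
have sp : (size p <= d.+1)%N by lia.
exists (revp d p); have sr : (size (revp d p) <= d.+1)%N by apply: size_poly.
apply: (mulfI (expf_neq0 d zz_neq0)); rewrite res1_rev // revpK //.
by rewrite -exprnN mulrA mulfV ?mul1r ?expf_neq0 ?zz_neq0.
Qed.

Lemma res0_frac (f : Kz) : exists q p, q != 0 /\ res0 q * f = res0 p.
Proof.
elim/quotW: f => -[[n d] /= d0]; exists d, n; split=> //.
rewrite /Defs.res0; unlock FracField.tofrac.
rewrite -[LHS]FracField.pi_mul; apply/eqmodP.
by rewrite /= FracField.equivfE /FracField.mulf !numden_Ratio
  ?(oner_eq0, mulf_neq0) //= mulr1 mul1r.
Qed.

(** Numerator and denominator are reversed with the same n, so the factors z^n cancel. *)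
Lemma res1_frac (f : Kz) : exists q p, q != 0 /\ res1 q * f = res1 p.
Proof.
have [q [p [q0 e]]] := res0_frac f; pose n := maxn (size p) (size q).
have sp : (size p <= n.+1)%N by rewrite leqW ?leq_maxl.
have sq : (size q <= n.+1)%N by rewrite leqW ?leq_maxr.
have sr s : (size (revp n s) <= n.+1)%N by apply: size_poly.
exists (revp n q), (revp n p); split.
  apply: contraNneq q0 => r0; rewrite -(revpK sq) r0; apply/eqP/polyP => i.
  by rewrite coef_poly !coef0 if_same.
apply: (mulfI (expf_neq0 n zz_neq0)).
by rewrite mulrA !res1_rev // !revpK.
Qed.

Lemma laurentD f g : laurent f -> laurent g -> laurent (f + g).
Proof.
case=> p [m ->] [q [n ->]]; exists (p * 'X^n + q * 'X^m), (m + n)%N.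
by rewrite rmorphD !rmorphM !rmorphXn /= res0X exprD addf_div ?expf_neq0 ?zz_neq0.
Qed.

Lemma laurent_sum (I : Type) (s : seq I) (P : pred I) (F : I -> Kz) :
  (forall i, P i -> laurent (F i)) -> laurent (\sum_(i <- s | P i) F i).
Proof. by move=> h; elim/big_ind: _ => //; [exact: laurent0|exact: laurentD]. Qed.

Lemma laurent_prod (I : Type) (s : seq I) (P : pred I) (F : I -> Kz) :
  (forall i, P i -> laurent (F i)) -> laurent (\prod_(i <- s | P i) F i).
Proof.
move=> h; elim/big_ind: _ => //; last exact: laurentM.
by exists 1, 0%N; rewrite rmorph1 divr1.
Qed.

Lemma laurent_mulmx m n p (A : 'M[Kz]_(m, n)) (B : 'M_(n, p)) :
  laurent_mx A -> laurent_mx B -> laurent_mx (A *m B).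
Proof. by move=> hA hB i j; rewrite mxE; apply: laurent_sum => l _; apply: laurentM. Qed.

Lemma laurent_det n (A : 'M[Kz]_n) : laurent_mx A -> laurent (\det A).
Proof.
move=> hA; apply: laurent_sum => s _; apply: laurentM.
  by exists ((-1) ^+ perm.odd_perm s), 0%N; rewrite rmorphXn rmorphN1 divr1.
by apply: laurent_prod.
Qed.

Lemma laurent_res0 p : laurent (res0 p).
Proof. by exists p, 0%N; rewrite divr1. Qed.

Lemma laurent_res1 p : laurent (res1 p).
Proof.
exists (revp (size p) p), (size p); rewrite -res1_rev // [RHS]mulrC.
by rewrite mulKf ?expf_neq0 ?zz_neq0.
Qed.

Lemma laurent0_col r (u : 'cV[Kz]_r) : laurent_mx u ->
  exists n (v : 'cV[{poly k}]_r), u = zz ^- n *: map_mx res0 v.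
Proof.
move=> hu; have /choice [f hf] : forall i, exists x : {poly k} * nat,
    u i 0 = res0 x.1 / zz ^+ x.2.
  by move=> i; have [p [n ->]] := hu i 0; exists (p, n).
pose N := (\max_i (f i).2)%N; exists N.
exists (\col_i ((f i).1 * 'X^(N - (f i).2))); apply/colP => i.
rewrite !mxE hf rmorphM rmorphXn /= res0X.
rewrite -[in zz ^- N](subnK (leq_bigmax i : ((f i).2 <= N)%N)).
by rewrite exprD [RHS]mulrC invfM mulrA mulfK ?expf_neq0 ?zz_neq0.
Qed.

Lemma laurent1_col r (u : 'cV[Kz]_r) : laurent_mx u ->
  exists n (v : 'cV[{poly k}]_r), u = zz ^+ n *: map_mx res1 v.
Proof.
case/laurent0_col => n [v ->]; pose N := (\max_i size (v i 0%R))%N.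
have sv i : (size (v i 0%R) <= N.+1)%N by rewrite leqW // (leq_bigmax i).
(* With w = 1/z, z^-n p equals z^N times w^n times the reversal of p read in w. *)
exists N, ('X^n *: map_mx (revp N) v); apply/colP => i.
rewrite !mxE rmorphM rmorphXn /= res1X mulrCA res1_rev ?size_poly // revpK //.
by rewrite exprVn.
Qed.

End Charts.

(** * Submodules of free modules over k[z] *)

Section FreeSubmodules.
Variable k : fieldType.
Implicit Types r s : nat.

Lemma submoduleZ r (M : set 'cV[{poly k}]_r) p u : submodule M ->
  M u -> M (p *: u).
Proof. by case=> h0 h hu; rewrite -[p *: u]addr0; apply: h. Qed.

Lemma submodule_mulmx r s (M : set 'cV[{poly k}]_r) (P : 'M_(r, s)) u :
  submodule M -> (forall j, M (col j P)) -> M (P *m u).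
Proof.
move=> hM hP; have -> : P *m u = \sum_j u j 0 *: col j P.
  apply/colP => i; rewrite mxE summxE; apply: eq_bigr => j _.
  by rewrite !mxE mulrC.
elim/big_rec: _ => [|j x _ hx]; first by case: hM.
by apply: hM.2 => //; apply: hP.
Qed.

(** A nonzero element of least size is a generator: remainders modulo it stay in I. *)
Lemma poly_ideal_principal (I : set {poly k}) : I 0 ->
  (forall p u v, I u -> I v -> I (p * u + v)) ->
  exists2 d, I d & forall x, I x -> d %| x.
Proof.
move=> I0 Ilin; case: (pselect (exists2 x, I x & x != 0)) => [[x Ix x0]|h].
  have ex : exists n, `[< exists y, [/\ I y, y != 0 & size y = n] >].
    by exists (size x); apply/asboolP; exists x.
  case: (ex_minnP ex) => n /asboolP [d [Id d0 sd]] dmin.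
  exists d => // y Iy; apply/modp_eq0P/eqP/contraT => m0.
  have : (n <= size (y %% d)%R)%N.
    apply: dmin; apply/asboolP; exists (y %% d); split=> //.
    have -> : y %% d = - (y %/ d) * d + y.
      by rewrite {3}(divp_eq y d) mulNr addKr.
    exact: Ilin.
  by rewrite -sd leqNgt ltn_modp d0.
exists 0 => // x Ix; case: (eqVneq x 0) => [->|x0]; first exact: dvdp0.
by case: h; exists x.
Qed.

(** Induction on r. The first coordinates of elements of M form an ideal, generated by some d
    attained at v0; the elements with first coordinate 0 have a basis P by induction. If d is
    nonzero, v0 completes P to a basis of M. *)
Lemma submodule_free r (M : set 'cV[{poly k}]_r) : submodule M ->
  exists s (P : 'M[{poly k}]_(r, s)),
    injective (fun u : 'cV_s => P *m u) /\ M = range (fun u : 'cV_s => P *m u).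
Proof.
elim: r M => [|r IH]; last change (r.+1) with (1 + r)%N; move=> M hM.
  exists 0%N, 0; split=> [u v _|]; first by apply/matrixP => -[].
  rewrite eqEsubset; split=> [u _|u _]; first by exists 0 => //; apply/matrixP => -[].
  by have -> : u = 0; [apply/matrixP => -[] | case: hM].
pose I : set {poly k} := [set x | exists2 v, M v & v 0 0 = x]%classic.
have [||d [v0 Mv0 dv0] dI] := @poly_ideal_principal I.
- by exists 0; [case: hM | rewrite mxE].
- move=> p _ _ [u Mu <-] [v Mv <-]; exists (p *: u + v); first exact: hM.2.
  by rewrite !mxE.
pose M' : set 'cV[{poly k}]_r := [set v | M (col_mx (0 : 'M_1) v)]%classic.
have [|s [P [Pinj eM']]] := IH M'.
  split=> [|p u v Mu Mv]; first by rewrite /M' /= col_mx0; case: hM.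
  rewrite /M' /= -[0]addr0 -[X in X + _](scaler0 _ p) -add_col_mx -scale_col_mx.
  exact: hM.2.
have MP u : M (col_mx (0 : 'M_1) (P *m u)).
  by have : M' (P *m u) by rewrite eM'; exists u.
have M0 v : M v -> v 0 0 = 0 -> exists u, v = col_mx (0 : 'M_1) (P *m u).
  move=> Mv v00; have ev : v = col_mx (0 : 'M_1) (dsubmx v).
    rewrite -[LHS]vsubmxK; congr col_mx; apply/matrixP => i j.
    by rewrite !ord1 !mxE -[RHS]v00; congr (v _ _); apply: val_inj.
  have : M' (dsubmx v) by rewrite /M' /= -ev.
  by rewrite eM' => -[u _ eu]; exists u; rewrite eu.
have c0 m (v : 'cV[{poly k}]_m) (x : 'M_1) : (col_mx x v) 0 0 = x 0 0.
  by rewrite -(col_mxEu x v); congr (_ _ _); apply: val_inj.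
have [d0|d0] := eqVneq d 0.
  exists s, (col_mx (0 : 'M_(1, s)) P); split.
    move=> u v /=; rewrite !mul_col_mx !mul0mx => /eq_col_mx [_].
    exact: Pinj.
  rewrite eqEsubset; split=> [v Mv|_ [u _ <-]] /=; last first.
    by rewrite mul_col_mx mul0mx.
  have [|u ->] := M0 v Mv.
    by apply/eqP; rewrite -dvd0p -d0; apply: dI; exists v.
  by exists u => //; rewrite mul_col_mx mul0mx.
exists (1 + s)%N, (row_mx v0 (col_mx (0 : 'M_(1, s)) P)).
have eP (u : 'cV[{poly k}]_(1 + s)) : row_mx v0 (col_mx (0 : 'M_(1, s)) P) *m u
    = u 0 0 *: v0 + col_mx (0 : 'M_1) (P *m dsubmx u).
  rewrite -{1}(vsubmxK u) mul_row_col mul_col_mx mul0mx; congr (_ + _).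
  rewrite [usubmx u]mx11_scalar mul_mx_scalar mxE; congr (u _ _ *: _).
  exact: val_inj.
split=> [u v /=|].
  rewrite !eP => e; have euv : u 0 0 = v 0 0.
    have e00 x w : (x *: v0 + col_mx (0 : 'M_1) w) 0 0 = x * d.
      by rewrite mxE c0 !mxE addr0 dv0.
    by apply: (mulIf d0); rewrite -(e00 _ (P *m dsubmx u)) e e00.
  rewrite -(vsubmxK u) -(vsubmxK v); congr col_mx.
    apply/matrixP => i j; rewrite !ord1 !mxE.
    by rewrite (_ : lshift s 0 = 0); [|apply: val_inj].
  by move: e; rewrite euv => /addrI /eq_col_mx [_] /Pinj.
rewrite eqEsubset; split=> [v Mv|_ [u _ <-]] /=; last first.
  by rewrite eP; apply: hM.2.
have /dvdpP [q eq] : d %| v 0 0 by apply: dI; exists v.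
have [||u eu] := M0 (- q *: v0 + v); first exact: hM.2.
  by rewrite !mxE eq dv0 mulNr addNr.
exists (col_mx q%:M u) => //; rewrite eP col_mxKd c0 mxE eqxx -eu.
by rewrite scaleNr addNKr.
Qed.

End FreeSubmodules.

(** * Coherent subsheaves *)

Lemma scale_eqV (F : fieldType) m n (x : F) (A B : 'M[F]_(m, n)) :
  x != 0 -> A = x *: B -> B = x^-1 *: A.
Proof. by move=> x0 ->; rewrite scalerK. Qed.

Lemma scale_eqVK (F : fieldType) m n (x : F) (A B : 'M[F]_(m, n)) :
  x != 0 -> A = x^-1 *: B -> B = x *: A.
Proof. by move=> x0 ->; rewrite scalerKV. Qed.

Lemma range_factor (R : pzRingType) r s m (P : 'M[R]_(r, s)) (A : 'M_(r, m)) :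
  (forall j, range (fun u : 'cV_s => P *m u) (col j A)) -> exists U, A = P *m U.
Proof.
move=> h; have /choice [f hf] : forall j, exists u, P *m u = col j A.
  by move=> j; have [u _ eu] := h j; exists u.
exists (\matrix_(i, j) f j i 0); apply/matrixP => i j.
have := congr1 (fun w : 'cV_r => w i 0) (hf j); rewrite !mxE => <-.
by apply: eq_bigr => l _; rewrite !mxE.
Qed.

(** * Clearing denominators, uniformly in the two chart embeddings *)

Section ClearDenominators.
Variable k : fieldType.
Local Notation Kz := {fraction {poly k}}.
Variable phi : {rmorphism {poly k} -> Kz}.
Hypothesis phi_inj : injective phi.
Hypothesis phi_frac : forall f, exists q p, q != 0 /\ phi q * f = phi p.

Lemma map_mx_injective m n : injective (@map_mx _ _ phi m n).
Proof.
move=> A B e; apply/matrixP => i j; apply: phi_inj.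
by have := congr1 (fun M : 'M_(m, n) => M i j) e; rewrite !mxE.
Qed.

Lemma mulmx_inj0 r s m (P : 'M[{poly k}]_(r, s)) (X : 'M_(s, m)) :
  injective (fun u : 'cV_s => P *m u) -> P *m X = 0 -> X = 0.
Proof.
move=> Pinj e; apply/matrixP => i j; have : col j X = 0.
  by apply: Pinj; rewrite /= mulmx0 colE mulmxA e mul0mx.
by move=> /colP /(_ i); rewrite !mxE.
Qed.

Lemma clear_mx m n (B : 'M[Kz]_(m, n)) :
  exists2 q, q != 0 & exists C, phi q *: B = map_mx phi C.
Proof.
have /choice [f hf] : forall p : 'I_m * 'I_n, exists x : {poly k} * {poly k},
    x.1 != 0 /\ phi x.1 * B p.1 p.2 = phi x.2.
  by move=> p; have [q [c h]] := phi_frac (B p.1 p.2); exists (q, c).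
exists (\prod_p (f p).1).
  by apply/prodf_neq0 => p _; case: (hf p).
have /choice [g hg] : forall p : 'I_m * 'I_n, exists x : {poly k},
    phi (\prod_p (f p).1) * B p.1 p.2 = phi x.
  move=> p; exists (\prod_(i | i != p) (f i).1 * (f p).2).
  by rewrite (bigD1 p) //= !rmorphM -(proj2 (hf p)) mulrAC mulrC.
by exists (\matrix_(i, j) g (i, j)); apply/matrixP => i j; rewrite !mxE -(hg (i, j)).
Qed.

Lemma map_mulmx_inj0 r s m (P : 'M[{poly k}]_(r, s)) (X : 'M[Kz]_(s, m)) :
  injective (fun u : 'cV_s => P *m u) -> map_mx phi P *m X = 0 -> X = 0.
Proof.
move=> Pinj e; have [q q0 [C eC]] := clear_mx X.
have : map_mx phi (P *m C) = 0.
  by rewrite map_mxM -eC -scalemxAr e scaler0.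
rewrite -(map_mx0 phi) => /map_mx_injective /(mulmx_inj0 Pinj) C0.
have : phi q *: X = 0 by rewrite eC C0 map_mx0.
by move=> /eqP; rewrite scaler_eq0 -(rmorph0 phi) (inj_eq phi_inj) (negPf q0) => /eqP.
Qed.

(** A relation over k(z) between the columns becomes one over k[z] once denominators are cleared. *)
Lemma inj_rank r s (P : 'M[{poly k}]_(r, s)) :
  injective (fun u : 'cV_s => P *m u) -> \rank (map_mx phi P) = s.
Proof.
move=> Pinj; rewrite -mxrank_tr; apply/eqP; rewrite -/(row_free _) -kermx_eq0.
apply/eqP; apply: trmx_inj; rewrite trmx0; apply: (map_mulmx_inj0 Pinj).
by rewrite -[X in X *m _]trmxK -trmx_mul mulmx_ker trmx0.
Qed.

Definition phi_ker n r (B : 'M[Kz]_(n, r)) : set 'cV[{poly k}]_r :=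
  [set v | B *m map_mx phi v = 0]%classic.

Lemma phi_ker_submodule n r (B : 'M[Kz]_(n, r)) : submodule (phi_ker B).
Proof.
split=> [|p u v hu hv]; rewrite /phi_ker /= ?map_mx0 ?mulmx0 //.
by rewrite map_mxD map_mxZ mulmxDr -scalemxAr hu hv scaler0 addr0.
Qed.

(* The quotient by a kernel embeds in a free module, hence is free, and the
   quotient map splits. *)
Lemma phi_ker_summand n r (B : 'M[Kz]_(n, r)) : direct_summand (phi_ker B).
Proof.
have [q q0 [C eC]] := clear_mx B.
have kerC v : phi_ker B v <-> C *m v = 0.
  rewrite /phi_ker /=; split=> [e|e].
    by apply: map_mx_injective; rewrite map_mxM -eC -scalemxAl e scaler0 map_mx0.
  have : phi q *: (B *m map_mx phi v) = 0 by rewrite scalemxAl eC -map_mxM e map_mx0.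
  by move=> /eqP; rewrite scaler_eq0 -(rmorph0 phi) (inj_eq phi_inj) (negPf q0) => /eqP.
have [|s [Q [Qinj eQ]]] := @submodule_free k n (range (fun v : 'cV_r => C *m v)).
  split=> [|p _ _ [u _ <-] [v _ <-]]; first by exists 0 => //; rewrite mulmx0.
  by exists (p *: u + v) => //; rewrite mulmxDr -scalemxAr.
have [|C' eC'] := @range_factor _ _ _ _ Q C.
  by move=> j; rewrite -eQ; exists (delta_mx j 0) => //; rewrite colE.
have [|D eD] := @range_factor _ _ _ _ C Q.
  by move=> j; rewrite eQ; exists (delta_mx j 0) => //; rewrite colE.
have C'D : C' *m D = 1%:M.
  apply/eqP; rewrite -subr_eq0; apply/eqP/(mulmx_inj0 Qinj).
  by rewrite mulmxBr mulmx1 mulmxA -eC' -eD subrr.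
(* The columns of D lift a basis of the image of C, so D splits the quotient map C' and its range is
   a complement. *)
exists (range (fun u : 'cV_s => D *m u)); split.
- split=> [|p _ _ [u _ <-] [v _ <-]]; first by exists 0 => //; rewrite mulmx0.
  by exists (p *: u + v) => //; rewrite mulmxDr -scalemxAr.
- move=> v [/kerC e [u _ eu]]; move: e; rewrite -eu mulmxA -eD => e.
  by rewrite /= (mulmx_inj0 Qinj e) mulmx0.
- move=> v; exists (v - D *m (C' *m v)), (D *m (C' *m v)); split.
  + apply/kerC; by rewrite mulmxBr (mulmxA C D) -eD (mulmxA Q) -eC' subrr.
  + by exists (C' *m v).
  + by rewrite subrK.
Qed.

(** L reads the coordinates of the component along P, so that v - P L v lies in the complement M'.
    For v a column of P this difference also lies in the range of P, so it vanishes. *)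
Lemma summand_left_inverse r s (P : 'M[{poly k}]_(r, s)) :
  injective (fun u : 'cV_s => P *m u) ->
  direct_summand (range (fun u : 'cV_s => P *m u)) ->
  exists L, L *m P = 1%:M.
Proof.
move=> Pinj [M' [hM' hcap hsum]].
have /choice [f hf] : forall i : 'I_r, exists u : 'cV_s,
    M' (delta_mx i 0 - P *m u).
  move=> i; have [_ [u' [[u _ <-] hu' e]]] := hsum (delta_mx i 0).
  by exists u; rewrite e addrC addKr.
pose L := \matrix_(i, j) f j i 0; exists L.
have hL (v : 'cV_r) : M' (v - P *m (L *m v)).
  have -> : v - P *m (L *m v) = (1%:M - P *m L) *m v.
    by rewrite mulmxBl mul1mx mulmxA.
  apply: submodule_mulmx => // j; have := hf j; congr (M' _).
  rewrite !colE mulmxBl mul1mx -mulmxA -colE; congr (_ - P *m _).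
  by apply/colP => i; rewrite !mxE.
apply/eqP; rewrite -subr_eq0; apply/eqP/(mulmx_inj0 Pinj).
apply/matrixP => i j; set X := _ *m _; suff : col j X = 0.
  by move=> /colP /(_ i); rewrite !mxE.
apply: hcap; split.
  by exists (col j (L *m P - 1%:M)) => //; rewrite /X !colE mulmxA.
have := hL (col j P); move=> /(submoduleZ (-1) hM'); congr (M' _).
rewrite scaleN1r opprB /X mulmxBr mulmx1 !colE mulmxBl; congr (_ - _).
by rewrite !mulmxA.
Qed.

End ClearDenominators.

Section Sheaves.
Variable k : fieldType.
Local Notation Kz := {fraction {poly k}}.
Local Notation zz := (zz k).
Local Notation res0 := (@res0 k).
Local Notation res1 := (@res1 k).
Local Notation zz_neq0 := (zz_neq0 k).
Implicit Types (r s : nat).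

Lemma zz_laurent_scale m n (d : int) (A : 'M[Kz]_(m, n)) : laurent_mx A ->
  laurent_mx (zz ^ d *: A).
Proof.
by move=> hA i j; rewrite mxE; apply: laurentM; [exact: laurent_zz | exact: hA].
Qed.

(** * Saturated subsheaves with prescribed generic fibre *)

Section KerSheaf.
Variables (r : nat) (E : bundle k r) (n : nat) (B : 'M[Kz]_(n, r)).

(** B E^-1 kills E u exactly when B kills u, and a column over k[z, 1/z] is regular on either chart
    up to a power of z. *)
Fact ker_sheaf_glue u :
  loc0 (phi_ker res0 B) u <-> loc1 (phi_ker res1 (B *m invmx E)) (E *m u).
Proof.
have Eu := cocycle_unit E; split.
  case=> m [v [hv eu]]; have [|m' [w ew]] := @laurent1_col _ _ (E *m u).
    apply: laurent_mulmx; first exact: cocycle_laurent.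
    rewrite eu exprnN; apply: zz_laurent_scale => i j.
    by rewrite mxE; apply: laurent_res0.
  exists m', w; split=> //; rewrite /phi_ker /=.
  have -> : map_mx res1 w = zz ^- m' *: (E *m u).
    by apply: (scale_eqV _ ew); rewrite expf_neq0 ?zz_neq0.
  rewrite -scalemxAr mulmxA mulmxKV // eu -scalemxAr.
  by move: hv; rewrite /phi_ker /= => ->; rewrite !scaler0.
case=> m [v [hv eu]].
have eu' : u = zz ^+ m *: (invmx E *m map_mx res1 v).
  by rewrite scalemxAr -eu mulKmx.
have [|m' [w ew]] := @laurent0_col _ _ u.
  rewrite eu' -[zz ^+ m]/(zz ^ m%:Z); apply: zz_laurent_scale.
  apply: laurent_mulmx; first exact: cocycle_inv_laurent.
  by move=> i j; rewrite mxE; apply: laurent_res1.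
exists m', w; split=> //; rewrite /phi_ker /=.
have -> : map_mx res0 w = zz ^+ m' *: u.
  by apply: (scale_eqVK _ ew); rewrite expf_neq0 ?zz_neq0.
rewrite -scalemxAr eu' -scalemxAr mulmxA.
by move: hv; rewrite /phi_ker /= => ->; rewrite !scaler0.
Qed.

(* The saturated subsheaf with generic fibre ker B. *)
Definition ker_sheaf : subsheaf E :=
  Subsheaf (phi_ker_submodule res0 B) (phi_ker_submodule res1 (B *m invmx E))
    ker_sheaf_glue.

Lemma ker_sheaf_subbundle : subbundle ker_sheaf.
Proof.
split; apply: phi_ker_summand.
- exact: res0_inj.
- exact: res0_frac.
- exact: res1_inj.
- exact: res1_frac.
Qed.

(** Both parts are read off on U0: a nonzero kernel over k(z) contains nonzero polynomial vectors
    once denominators are cleared, and B = 0 if it kills all polynomial vectors. *)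
Lemma ker_sheaf_proper : (0 < \rank B < r)%N -> sub_proper ker_sheaf.
Proof.
case/andP => B0 Br; split=> -[h _].
  have := Br; rewrite ltnNge; apply/negP/negPn; rewrite -mxrank_tr row_leq_rank.
  rewrite -kermx_eq0; set X := kermx _; apply/eqP.
  have [q q0 [C eC]] := clear_mx (@res0_frac k) X^T.
  have : C = 0.
    apply/matrixP => i j; have : col j C = 0.
      apply: h; rewrite /= /phi_ker /= map_col colE mulmxA -eC -scalemxAr.
      by rewrite -[B]trmxK -trmx_mul mulmx_ker trmx0 scaler0 mul0mx.
    by move=> /colP /(_ i); rewrite !mxE.
  move=> C0; move: eC; rewrite C0 map_mx0 => /eqP; rewrite scaler_eq0 tofrac_eq0.
  by rewrite (negPf q0) /= => /eqP X0; rewrite -[X]trmxK X0 trmx0.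
suff B00 : B = 0 by rewrite B00 mxrank0 in B0.
apply/matrixP => i j; have := h (delta_mx j 0); rewrite /= /phi_ker /=.
by rewrite map_delta_mx -colE => /colP /(_ i); rewrite !mxE.
Qed.

Lemma hom_twistE t (Phi : bundle_hom E (twist t E)) :
  map_mx res1 (hom1 Phi) *m E = zz ^ (- t) *: (E *m map_mx res0 (hom0 Phi)).
Proof. by rewrite (eqP (hom_pairP Phi)) /= -scalemxAl. Qed.

(** The generic fibre suffices: on U1 the matrix of Phi is z^-t times the conjugate by E of its
    matrix on U0. *)
Lemma ker_sheaf_preserved t (Phi : bundle_hom E (twist t E)) :
  (forall u : 'cV_r, B *m u = 0 -> B *m (map_mx res0 (hom0 Phi) *m u) = 0) ->
  preserved Phi ker_sheaf.
Proof.
move=> hB; split=> v; rewrite /= /phi_ker /= map_mxM; first exact: hB.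
move=> e; have Eu := cocycle_unit E.
have -> : map_mx res1 (hom1 Phi) =
    zz ^ (- t) *: (E *m map_mx res0 (hom0 Phi) *m invmx E).
  by rewrite scalemxAl -hom_twistE mulmxK.
rewrite -scalemxAl -scalemxAr -!mulmxA mulKmx // hB ?scaler0 //.
by rewrite mulmxA.
Qed.
End KerSheaf.

(** * Local freeness of coherent subsheaves *)

Section Models.
Variables (r : nat) (E : bundle k r).
Implicit Type F : subsheaf E.

(** Take bases P0 and P1 of the two chart modules. By gluing, E P0 = P1 G and E^-1 P1 = P0 H with
    Laurent matrices G and H; injectivity of P0 and P1 makes these inverse to each other, and G is
    the transition matrix of N. *)
Lemma sub_model F : exists s (N : bundle k s), sub_iso N F.
Proof.
have Eu := cocycle_unit E.
have [s [P0 [P0inj eF0]]] := submodule_free (sub0P F).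
have [s1 [P1 [P1inj eF1]]] := submodule_free (sub1P F).
have F0col j : sub0 F (col j P0) by rewrite eF0; exists (delta_mx j 0); rewrite ?colE.
have F1col j : sub1 F (col j P1) by rewrite eF1; exists (delta_mx j 0); rewrite ?colE.
have /choice [g hg] : forall j : 'I_s, exists w : 'cV[Kz]_s1, laurent_mx w /\
    E *m map_mx res0 (col j P0) = map_mx res1 P1 *m w.
  move=> j; have : loc1 (sub1 F) (E *m map_mx res0 (col j P0)).
    by apply/sub_glue; exists 0%N, (col j P0); rewrite expr0 invr1 scale1r.
  case=> n [w [hw ->]]; move: hw; rewrite eF1 => -[x _ <-].
  exists (zz ^+ n *: map_mx res1 x).
  split; last by rewrite map_mxM scalemxAr.
  rewrite -[zz ^+ n]/(zz ^ n%:Z); apply: zz_laurent_scale => a b.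
  by rewrite mxE; apply: laurent_res1.
have /choice [h hh] : forall j : 'I_s1, exists w : 'cV[Kz]_s, laurent_mx w /\
    invmx E *m map_mx res1 (col j P1) = map_mx res0 P0 *m w.
  move=> j; have : loc0 (sub0 F) (invmx E *m map_mx res1 (col j P1)).
    by apply/sub_glue; exists 0%N, (col j P1); rewrite mulKVmx // expr0 scale1r.
  case=> n [w [hw ->]]; move: hw; rewrite eF0 => -[x _ <-].
  exists (zz ^- n *: map_mx res0 x).
  split; last by rewrite map_mxM scalemxAr.
  rewrite exprnN; apply: zz_laurent_scale => a b.
  by rewrite mxE; apply: laurent_res0.
pose G := \matrix_(i, j) g j i 0; pose H := \matrix_(i, j) h j i 0.
have eG : E *m map_mx res0 P0 = map_mx res1 P1 *m G.
  apply/matrixP => i j; have [_ /colP /(_ i)] := hg j.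
  rewrite map_col colE mulmxA -colE mxE => ->.
  by rewrite !mxE; apply: eq_bigr => l _; rewrite !mxE.
have eH : invmx E *m map_mx res1 P1 = map_mx res0 P0 *m H.
  apply/matrixP => i j; have [_ /colP /(_ i)] := hh j.
  rewrite map_col colE mulmxA -colE mxE => ->.
  by rewrite !mxE; apply: eq_bigr => l _; rewrite !mxE.
have GL : laurent_mx G by move=> i j; rewrite mxE; case: (hg j).
have HL : laurent_mx H by move=> i j; rewrite mxE; case: (hh j).
have HG : H *m G = 1%:M.
  apply/eqP; rewrite -subr_eq0; apply/eqP.
  apply: (map_mulmx_inj0 (@res0_inj k) (@res0_frac k) P0inj).
  by rewrite mulmxBr mulmx1 mulmxA -eH -mulmxA -eG mulKmx // subrr.
have GH : G *m H = 1%:M.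
  apply/eqP; rewrite -subr_eq0; apply/eqP.
  apply: (map_mulmx_inj0 (@res1_inj k) (@res1_frac k) P1inj).
  by rewrite mulmxBr mulmx1 mulmxA -eG -mulmxA -eH mulKVmx // subrr.
have ess1 : s = s1.
  by apply/eqP; rewrite eqn_leq (mulmx1_min HG) (mulmx1_min GH).
subst s1.
have [Hu Gu] := mulmx1_unit HG.
have iG : invmx G = H by rewrite -[LHS]mul1mx -HG -mulmxA mulmxV // mulmx1.
have iGL : laurent_mx (invmx G) by rewrite iG.
exists s, (Bundle Gu GL iGL).
have cP : hom_compat (Bundle Gu GL iGL) E (P0, P1) by rewrite /hom_compat /= eG.
by exists (Defs.Hom cP); split.
Qed.

End Models.
End Sheaves.

(** * Degrees and slopes *)

Section Degrees.
Variable k : fieldType.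
Local Notation Kz := {fraction {poly k}}.
Local Notation zz := (zz k).
Local Notation res0 := (@res0 k).
Local Notation res1 := (@res1 k).
Local Notation zz_neq0 := (zz_neq0 k).
Implicit Types (r s : nat).

(** The equation says that the nonzero constant c' is a section of O(m - n), so m - n >= 0. *)
Lemma zz_exp_le (c c' : k) (m n : int) : c' != 0 ->
  res0 c%:P * zz ^ m = res0 c'%:P * zz ^ n -> n <= m.
Proof.
move=> c'0 e; have : res1 c%:P = zz ^ (- (m - n)) * res0 c'%:P.
  rewrite res1C; apply: (mulIf (expfz_neq0 m zz_neq0)); rewrite e.
  rewrite [RHS]mulrC mulrA -expfzDr ?zz_neq0 // [RHS]mulrC.
  by congr (_ * zz ^ _); lia.
move=> /section_degree; rewrite polyC_eq0 => /(_ c'0); rewrite size_polyC c'0 /=.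
by rewrite subr_ge0.
Qed.

(** Two such exponents bound each other by [zz_exp_le], so the set in [degree] is a singleton. *)
Lemma degree_eq r (E : bundle k r) c d : c != 0 ->
  \det E = res0 c%:P * zz ^ (- d) -> degree E = d.
Proof.
move=> c0 e; rewrite /degree; set S := (X in xget _ X).
have [c' c'0 e'] : S (xget 0 S) by apply: xgetPex; exists d; exists c.
move: e'; rewrite e => e'; have := zz_exp_le c'0 e'; have := zz_exp_le c0 (esym e').
by rewrite !lerN2 => h1 h2; apply/le_anti; rewrite h1 h2.
Qed.

(** The determinant and its inverse are Laurent, so their numerators p and q multiply to a power of
    z; hence p is a constant times a power of z. *)
Lemma degree_det r (E : bundle k r) :
  exists2 c, c != 0 & \det E = res0 c%:P * zz ^ (- degree E).
Proof.
suff [c [d [c0 e]]] : exists c d, c != 0 /\ \det E = res0 c%:P * zz ^ (- d).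
  by exists c => //; rewrite (degree_eq c0 e).
have [p [n ep]] := laurent_det (cocycle_laurent E).
have [q [m eq]] := laurent_det (cocycle_inv_laurent E).
have e1 : \det E * \det (invmx E) = 1.
  by rewrite -det_mulmx mulmxV ?det1 ?cocycle_unit.
have epq : p * q = 'X^(n + m).
  apply: res0_inj; rewrite rmorphM rmorphXn /= res0X exprD.
  have -> : res0 p = \det E * zz ^+ n by rewrite ep divfK ?expf_neq0 ?zz_neq0.
  have -> : res0 q = \det (invmx E) * zz ^+ m by rewrite eq divfK ?expf_neq0 ?zz_neq0.
  by rewrite mulrACA e1 mul1r.
have : p %| ('X - 0%:P) ^+ (n + m) by rewrite subr0 -epq dvdp_mulr.
case/dvdp_exp_XsubCP => l _; rewrite subr0 => /eqpP [[u v] /= /andP [u0 v0] euv].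
exists (v / u), (n%:Z - l%:Z); split; first by rewrite mulf_neq0 ?invr_eq0.
have -> : \det E = res0 p * zz ^ (- n%:Z) by rewrite ep exprnN.
have -> : p = (v / u)%:P * 'X^l.
  by rewrite mul_polyC mulrC -scalerA -euv scalerA mulVf ?scale1r.
rewrite rmorphM rmorphXn /= res0X -[zz ^+ l]/(zz ^ l%:Z) -mulrA -expfzDr ?zz_neq0 //.
by rewrite opprB.
Qed.

Lemma degree_split r (a : 'I_r -> int) :
  degree (split_bundle k a) = \sum_i a i.
Proof.
apply: (@degree_eq _ _ 1); first exact: oner_neq0.
rewrite rmorph1 mul1r /= /split_mx det_diag -sumrN.
rewrite (big_morph (fun d => zz ^ d) (fun m n => expfzDr m n zz_neq0) (expr0z zz)).
by apply: eq_bigr => i _; rewrite mxE.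
Qed.

Lemma hom_det r (N E : bundle k r) (j : bundle_hom N E) :
  res1 (\det (hom1 j)) * \det N = \det E * res0 (\det (hom0 j)).
Proof. by rewrite -!det_map_mx -!det_mulmx (eqP (hom_pairP j)). Qed.

(** Invertible matrices over k[z] have constant determinants, so those of N and E differ by a
    constant factor. *)
Lemma hom_unit_degree r (N E : bundle k r) (j : bundle_hom N E) :
  hom0 j \in unitmx -> hom1 j \in unitmx -> degree N = degree E.
Proof.
rewrite !unitmxE !poly_unitE => /andP [/size_poly1P [c0 nc0 e0] _].
move=> /andP [/size_poly1P [c1 nc1 e1] _].
have [c nc e] := degree_det E; apply: (@degree_eq _ _ (c1^-1 * c * c0)).
  by rewrite !mulf_neq0 ?invr_eq0.
have := hom_det j; rewrite e0 e1 e res1C => h.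
have c1' : res0 c1%:P != 0 by rewrite tofrac_eq0 polyC_eq0.
apply: (mulfI c1'); rewrite h mulrA -rmorphM -polyCM !mulrA divff // mul1r.
by rewrite polyCM rmorphM mulrAC.
Qed.

Lemma degree_iso r (E E' : bundle k r) : bundle_iso E E' -> degree E = degree E'.
Proof.
case=> f [g [e0 e1 _ _]]; apply: (@hom_unit_degree _ _ _ f).
  by case: (mulmx1_unit e0).
by case: (mulmx1_unit e1).
Qed.

(** * Rank and degree of a subsheaf *)

Section SubDegree.
Variables (r : nat) (E : bundle k r) (F : subsheaf E).

(** Two bases of the same submodule differ by an invertible matrix; on the two charts these matrices
    form an isomorphism from N to N'. *)
Lemma sub_iso_unique s s' (N : bundle k s) (N' : bundle k s') :
  sub_iso N F -> sub_iso N' F -> s = s' /\ degree N = degree N'.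
Proof.
move=> [j [inj0 inj1 e0 e1]] [j' [inj0' inj1' e0' e1']].
have fac (m n : nat) (P : 'M[{poly k}]_(r, m)) (P' : 'M[{poly k}]_(r, n)) :
    range (fun u : 'cV_m => P *m u) = range (fun u : 'cV_n => P' *m u) ->
    exists U, P = P' *m U.
  move=> h; apply: range_factor => i; rewrite -h.
  by exists (delta_mx i 0) => //; rewrite colE.
have [U eU] := fac _ _ _ _ (etrans (esym e0) e0').
have [V eV] := fac _ _ _ _ (etrans (esym e0') e0).
have [U1 eU1] := fac _ _ _ _ (etrans (esym e1) e1').
have [V1 eV1] := fac _ _ _ _ (etrans (esym e1') e1).
have canc (m n : nat) (P : 'M[{poly k}]_(r, m)) (P' : 'M[{poly k}]_(r, n)) W W' :
    injective (fun u : 'cV_m => P *m u) ->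
    P = P' *m W -> P' = P *m W' -> W' *m W = 1%:M.
  move=> Pinj h h'; apply/eqP; rewrite -subr_eq0; apply/eqP/(mulmx_inj0 Pinj).
  by rewrite mulmxBr mulmx1 mulmxA -h' -h subrr.
have VU := canc _ _ _ _ _ _ inj0 eU eV; have UV := canc _ _ _ _ _ _ inj0' eV eU.
have VU1 := canc _ _ _ _ _ _ inj1 eU1 eV1.
have ess : s = s' by apply/eqP; rewrite eqn_leq (mulmx1_min VU) (mulmx1_min UV).
subst s'; split=> //.
have cU : hom_compat N N' (U, U1).
  apply/eqP/eqP; rewrite -subr_eq0; apply/eqP.
  apply: (map_mulmx_inj0 (@res1_inj k) (@res1_frac k) inj1') => /=.
  rewrite mulmxBr !mulmxA -map_mxM -eU1 (eqP (hom_pairP j')) -mulmxA -map_mxM -eU.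
  by rewrite (eqP (hom_pairP j)) subrr.
apply: (@hom_unit_degree _ _ _ (Defs.Hom cU)).
  by case: (mulmx1_unit VU).
by case: (mulmx1_unit VU1).
Qed.

Lemma sub_rankE s (N : bundle k s) : sub_iso N F -> sub_rank F = s.
Proof.
move=> hN; rewrite /sub_rank; set S := (X in xget _ X).
have [N' hN'] : S (xget 0%N S) by apply: xgetPex; exists s; exists N.
by have [] := sub_iso_unique hN' hN.
Qed.

Lemma sub_degreeE s (N : bundle k s) : sub_iso N F -> sub_degree F = degree N.
Proof.
move=> hN; rewrite /sub_degree; set S := (X in xget _ X).
have [s' [N' [hN' <-]]] : S (xget 0 S).
  by apply: xgetPex; exists (degree N); exists s, N.
by have [] := sub_iso_unique hN' hN.
Qed.

Lemma sub_slopeE s (N : bundle k s) : sub_iso N F ->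
  sub_slope F = (degree N)%:~R / s%:R.
Proof. by move=> hN; rewrite /sub_slope (sub_rankE hN) (sub_degreeE hN). Qed.

(** The determinant of j gives a nonzero section of O(deg E - deg N). If that degree is not
    positive, the section is constant, so j is invertible on both charts and F is all of E. *)
Lemma full_rank_degree (N : bundle k r) : sub_iso N F -> ~ sub_full F ->
  degree N < degree E.
Proof.
move=> [j [inj0 inj1 e0 e1]] nfull; rewrite ltNge; apply/negP => le_deg.
have [cN cN0 eN] := degree_det N; have [cE cE0 eE] := degree_det E.
have d0 : \det (hom0 j) != 0.
  have := inj_rank (@res0_inj k) (@res0_frac k) inj0 => /eqP; rewrite -/(row_free _).
  by rewrite row_free_unit unitmxE unitfE det_map_mx tofrac_eq0.
have e : res1 (\det (hom1 j) * cN%:P) =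
    zz ^ (- (degree E - degree N)) * res0 (cE%:P * \det (hom0 j)).
  have := hom_det j; rewrite eN eE !rmorphM /= res1C => h.
  apply: (mulIf (expfz_neq0 (- degree N) zz_neq0)); rewrite -mulrA h.
  have -> : zz ^ (- degree E) = zz ^ (- (degree E - degree N)) * zz ^ (- degree N).
    by rewrite -expfzDr ?zz_neq0 // opprB addrAC subrr add0r.
  by rewrite [RHS]mulrAC [RHS]mulrCA [RHS]mulrA.
have ne0 : cE%:P * \det (hom0 j) != 0 by rewrite mulf_neq0 ?polyC_eq0.
have h := section_degree e ne0.
have aux (n : nat) (x y : int) :
    (0 < n)%N -> n.-1%:Z <= x - y -> x <= y -> n = 1%N /\ x = y by lia.
have [|sz eq_deg] := aux _ _ _ _ h le_deg; first by rewrite size_poly_gt0.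
have /eqP/size_poly1P [c0 c00 ec0] : size (\det (hom0 j)) = 1%N.
  by rewrite -sz mul_polyC size_scale.
have u0 : hom0 j \in unitmx.
  by rewrite unitmxE ec0 poly_unitE size_polyC c00 coefC unitfE c00.
have u1 : hom1 j \in unitmx.
  move: e; rewrite eq_deg subrr oppr0 expr0z mul1r ec0 -polyCM -res1C => /res1_inj e.
  have : \det (hom1 j) * cN%:P \is a GRing.unit.
    by rewrite e poly_unitE size_polyC coefC unitfE mulf_neq0.
  by rewrite unitrM -unitmxE => /andP [].
case: nfull; split=> v.
  by rewrite e0; exists (invmx (hom0 j) *m v); rewrite //= mulKVmx.
by rewrite e1; exists (invmx (hom1 j) *m v); rewrite //= mulKVmx.
Qed.
End SubDegree.

(** * Invariant spans and stability *)

Section Stability.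
Variables (r : nat) (E : bundle k r) (t : int) (Phi : bundle_hom E (twist t E)).
Local Notation Phi0 := (map_mx res0 (hom0 Phi)).

(** The column span of Q is the kernel of B, the transposed cokernel of Q^T, so [ker_sheaf E B] is a
    proper invariant subbundle. *)
Lemma no_invariant_span s (Q : 'M[Kz]_(r, s)) C : no_invariant_subbundle Phi ->
  Phi0 *m Q = Q *m C -> (0 < \rank Q < r)%N -> False.
Proof.
move=> noinv hQ /andP [Q0 Qr]; pose B := (cokermx Q^T)^T.
have BQ : B *m Q = 0.
  by apply: trmx_inj; rewrite trmx_mul trmxK mulmx_coker trmx0.
apply: (noinv (ker_sheaf E B)); first exact: ker_sheaf_subbundle.
  apply: ker_sheaf_proper; rewrite mxrank_tr mxrank_coker mxrank_tr.
  by rewrite subn_gt0 Qr ltn_subrL Q0 (leq_trans _ Qr).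
apply: ker_sheaf_preserved => u Bu.
have : (u^T <= Q^T)%MS.
  by rewrite submxE; apply/eqP; apply: trmx_inj; rewrite trmx_mul trmxK Bu trmx0.
case/submxP => D /(congr1 trmx); rewrite trmxK trmx_mul trmxK => ->.
by rewrite !mulmxA -[B *m _ *m _]mulmxA hQ !mulmxA BQ !mul0mx.
Qed.

Lemma preserved_factor (F : subsheaf E) s (P : 'M[{poly k}]_(r, s)) :
  sub0 F = range (fun u : 'cV_s => P *m u) -> preserved Phi F ->
  exists A, hom0 Phi *m P = P *m A.
Proof.
move=> eF [h _]; apply: range_factor => j; rewrite -eF colE -mulmxA -colE.
by apply: h; rewrite eF; exists (delta_mx j 0); rewrite ?colE.
Qed.

Lemma no_invariant_stable : no_invariant_subbundle Phi -> stable Phi.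
Proof.
move=> noinv F [nz nf] hF; have [s [N hN]] := sub_model F.
rewrite (sub_slopeE hN) /slope; have [j [inj0 inj1 e0 e1]] := hN.
have rkj := inj_rank (@res0_inj k) (@res0_frac k) inj0.
have s0 : (0 < s)%N.
  case: s N hN j inj0 inj1 e0 e1 {rkj} => // N _ j _ _ e0 e1; case: nz.
  by split=> v; rewrite ?e0 ?e1 => -[u _ <-]; rewrite [u]flatmx0 /= mulmx0.
have : (s <= r)%N by rewrite -rkj rank_leq_row.
(* In lower rank the generic span of F would be invariant; in full rank the slopes compare as the
   degrees. *)
rewrite leq_eqVlt => /orP [/eqP esr|sr]; last first.
  have [A eA] := preserved_factor e0 hF.
  case: (@no_invariant_span _ (map_mx res0 (hom0 j)) (map_mx res0 A)) => //.
    by rewrite -!map_mxM eA.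
  by rewrite rkj s0.
subst s; rewrite ltr_pM2r ?invr_gt0 ?ltr0n // ltr_int.
exact: full_rank_degree hN nf.
Qed.
End Stability.
End Degrees.

(** * Polynomials in a matrix *)

Section MatrixPolynomials.

Lemma horner_mx_sum (R : comNzRingType) n (A : 'M[R]_n.+1) (p : {poly R}) N :
  (size p <= N)%N -> horner_mx A p = \sum_(i < N) p`_i *: A ^+ i.
Proof.
move=> sp; have {1}-> : p = \sum_(i < N) p`_i *: 'X^i.
  rewrite -(poly_def _ (fun i => p`_i)); apply/polyP => i; rewrite coef_poly.
  by case: ltnP => // lt_ni; rewrite nth_default ?(leq_trans sp).
rewrite rmorph_sum /=; apply: eq_bigr => i _.
by rewrite -mul_polyC rmorphM rmorphXn /= horner_mx_C horner_mx_X -mulmxE mul_scalar_mx.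
Qed.

Lemma exp_mulmx_comm (R : comNzRingType) r s (A : 'M[R]_r)
  (Q : 'M_(r, s)) (C : 'M_s) m :
  A *m Q = Q *m C -> A ^+ m *m Q = Q *m C ^+ m.
Proof.
move=> h; elim: m => [|m IH]; first by rewrite !expr0 mul1mx mulmx1.
by rewrite !exprS -!mulmxE -mulmxA IH mulmxA h -mulmxA.
Qed.

Lemma horner_mx_comm (R : comNzRingType) r s (A : 'M[R]_r.+1)
  (Q : 'M_(r.+1, s.+1)) (C : 'M_s.+1) p :
  A *m Q = Q *m C -> horner_mx A p *m Q = Q *m horner_mx C p.
Proof.
move=> h; rewrite !(@horner_mx_sum _ _ _ p (size p)) // mulmx_suml mulmx_sumr.
by apply: eq_bigr => i _; rewrite -scalemxAl -scalemxAr (exp_mulmx_comm _ h).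
Qed.

(** The characteristic polynomial of cA is c^n times that of A evaluated at X/c. *)
Lemma char_poly_scale (F : fieldType) n (c : F) (A : 'M[F]_n) i :
  c != 0 -> (i <= n)%N ->
  (char_poly (c *: A))`_i = c ^+ (n - i) * (char_poly A)`_i.
Proof.
move=> c0 le_in; pose q := c^-1 *: 'X : {poly F}.
have e : char_poly (c *: A) = (c ^+ n)%:P * (char_poly A \Po q).
  rewrite /char_poly -[_ \Po q]/(comp_poly q _) -det_map_mx polyC_exp -detZ.
  congr (\det _); apply/matrixP => a b; rewrite !mxE rmorphB /= rmorphMn /=.
  rewrite comp_polyX comp_polyC mulrBr polyCM; congr (_ - _).
  by rewrite mulrnAr /q mul_polyC scalerA divff // scale1r.
rewrite e coefCM comp_polyE coef_sum; case: (ltnP i (size (char_poly A))) => hi; last first.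
  by rewrite size_char_poly ltnNge le_in in hi.
rewrite (bigD1 (Ordinal hi)) //= big1 => [|l nl]; last first.
  rewrite coefZ exprZn coefZ coefXn; case: eqP => [eil|_]; last by rewrite !mulr0.
  by case/eqP: nl; apply: val_inj.
rewrite addr0 coefZ exprZn coefZ coefXn eqxx mulr1 exprVn.
rewrite -[in c ^+ n](subnK le_in) exprD -mulrA; congr (_ * _).
by rewrite mulrCA divff ?expf_neq0 // mulr1.
Qed.

Lemma char_poly_conj (F : fieldType) n (N A : 'M[F]_n) : N \in unitmx ->
  char_poly (N *m A *m invmx N) = char_poly A.
Proof.
move=> uN; rewrite /char_poly.
have -> : char_poly_mx (N *m A *m invmx N) =
    map_mx polyC N *m char_poly_mx A *m map_mx polyC (invmx N).
  rewrite /char_poly_mx mulmxBr mulmxBl !map_mxM /=; congr (_ - _).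
  by rewrite mul_mx_scalar -scalemxAl -map_mxM /= mulmxV // map_mx1 scalemx1.
rewrite !det_mulmx mulrAC -det_mulmx -map_mxM /= mulmxV // map_mx1 det1.
by rewrite mul1r.
Qed.

(** P carries eigenvectors of C to eigenvectors of A, and L keeps them nonzero. The transposes are
    there because [eigenvalue] uses row vectors. *)
Lemma root_char_restrict (F : fieldType) r s (A : 'M[F]_r.+1) (P : 'M_(r.+1, s.+1))
  (C : 'M_s.+1) (L : 'M_(s.+1, r.+1)) mu :
  A *m P = P *m C -> L *m P = 1%:M -> root (char_poly C) mu -> root (char_poly A) mu.
Proof.
have trE n (B : 'M[F]_n.+1) : char_poly B = char_poly B^T.
  rewrite /char_poly -det_tr; congr (\det _); rewrite /char_poly_mx.
  by rewrite linearB /= tr_scalar_mx map_trmx.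
move=> AP LP; rewrite (trE _ A) (trE _ C) -!eigenvalue_root_char.
case/eigenvalueP => v vC v0; apply/eigenvalueP; exists (v *m P^T).
  by rewrite -mulmxA -trmx_mul AP trmx_mul mulmxA vC scalemxAl.
apply: contra v0 => /eqP h; apply/eqP.
by rewrite -[v]mulmx1 -trmx1 -LP trmx_mul mulmxA h mul0mx.
Qed.

(* Modulo the characteristic polynomial of A, the product over its roots mu of
   P - P(mu) vanishes, so P(A) divides the scalar prod_mu P(mu). *)
Lemma det_horner_mx_eq0 (k : closedFieldType) n (A : 'M[k]_n.+1)
    (P : {poly {poly k}}) :
  \det (horner_mx (map_mx polyC A) P) = 0 <->
  exists2 mu, root (char_poly A) mu & P.[mu%:P] = 0.
Proof.
(* An eigenvector v of A for mu satisfies v P(A) = P(mu) v = 0. *)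
split=> [det0|[mu]]; last first.
  rewrite -eigenvalue_root_char => /eigenvalueP [v vA v0] Pmu.
  apply/eqP/det0P; exists (map_mx polyC v).
    apply: contra v0 => /eqP e; apply/eqP/rowP => i; apply: polyC_inj.
    by have := congr1 (fun w : 'rV_n.+1 => w 0 i) e; rewrite !mxE.
  have hX m : map_mx polyC v *m map_mx polyC A ^+ m = mu%:P ^+ m *: map_mx polyC v.
    elim: m => [|m IH]; first by rewrite !expr0 mulmx1 scale1r.
    rewrite exprSr -mulmxE mulmxA IH -scalemxAl -map_mxM vA map_mxZ /= scalerA.
    by rewrite exprSr.
  rewrite (@horner_mx_sum _ _ _ P (size P)) // mulmx_sumr.
  transitivity (P.[mu%:P] *: map_mx polyC v); last by rewrite Pmu scale0r.
  rewrite horner_coef scaler_suml; apply: eq_bigr => i _.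
  by rewrite -scalemxAr hX scalerA.
have [rs ers] := closed_field_poly_normal (char_poly A).
rewrite (monicP (char_poly_monic A)) scale1r in ers.
(* By induction on the roots, since X - mu divides P - P(mu). *)
have [G [H e]] : exists G H, (\prod_(mu <- rs) ('X - mu%:P%:P)) * G =
    P * H + (\prod_(mu <- rs) - P.[mu%:P])%:P.
  elim: rs {ers} => [|mu rs [G [H IH]]].
    by exists 1, 0; rewrite !big_nil mulr0 add0r mulr1.
  have /factor_theorem [Q eQ] : root (P - P.[mu%:P]%:P) mu%:P.
    by rewrite /root !hornerE subrr.
  rewrite !big_cons; set X := \prod_(j <- rs) ('X - _) in IH *.
  set d := \prod_(j <- rs) - _ in IH *; set c := P.[_] in eQ *.
  exists (Q * G), (H * (P - c%:P) + d%:P); rewrite polyCM polyCN.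
  set Y := 'X - _ in eQ *.
  have -> : Y * X * (Q * G) = (Q * Y) * (X * G) by ring.
  by rewrite IH -eQ; ring.
(* At A the left-hand side vanishes by Cayley-Hamilton, so P(A) H(A) is a scalar matrix. Its
   determinant is 0, so some P(mu) is 0 in the domain k[z]. *)
have := congr1 (horner_mx (map_mx polyC A)) e.
rewrite rmorphM rmorphD rmorphM /= horner_mx_C.
have -> : \prod_(mu <- rs) ('X - mu%:P%:P) = char_poly (map_mx polyC A).
  rewrite -map_char_poly ers rmorph_prod; apply: eq_bigr => mu _.
  by rewrite rmorphB /= map_polyX map_polyC.
rewrite Cayley_Hamilton mul0r => /esym/eqP; rewrite addr_eq0 => /eqP.
move=> /(congr1 determinant); rewrite -mulmxE det_mulmx det0 mul0r -scaleN1r.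
rewrite detZ det_scalar => /esym/eqP.
rewrite mulf_eq0 !expf_eq0 /= oppr_eq0 oner_eq0 /= prodf_seq_eq0.
case/hasP => mu mu_rs /=; rewrite oppr_eq0 => /eqP Pmu; exists mu => //.
by rewrite ers root_prod_XsubC.
Qed.
End MatrixPolynomials.

(** * Sums of line bundles *)

Section SplitBundles.
Variable k : fieldType.
Local Notation Kz := {fraction {poly k}}.
Local Notation zz := (zz k).
Local Notation res0 := (@res0 k).
Local Notation res1 := (@res1 k).
Local Notation zz_neq0 := (zz_neq0 k).
Implicit Types (r s : nat).

(** A direct summand of full rank is everything: the left inverse of its basis matrix is square,
    hence two-sided. *)
Lemma proper_subbundle_rank r (E : bundle k r) (F : subsheaf E) s (N : bundle k s) :
  subbundle F -> sub_proper F -> sub_iso N F -> (0 < s < r)%N.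
Proof.
move=> [ds0 ds1] [nz nf] [j [inj0 inj1 e0 e1]].
have := inj_rank (@res0_inj k) (@res0_frac k) inj0 => rkj.
apply/andP; split.
  case: s N j inj0 inj1 e0 e1 {rkj} => // N j _ _ e0 e1; case: nz.
  by split=> v; rewrite ?e0 ?e1 => -[u _ <-]; rewrite [u]flatmx0 /= mulmx0.
have : (s <= r)%N by rewrite -rkj rank_leq_row.
rewrite leq_eqVlt => /orP [/eqP esr|//]; subst s; case: nf.
rewrite e0 in ds0; rewrite e1 in ds1.
have [L0 /mulmx1_unit [_ u0]] := summand_left_inverse inj0 ds0.
have [L1 /mulmx1_unit [_ u1]] := summand_left_inverse inj1 ds1.
split=> v.
  by rewrite e0; exists (invmx (hom0 j) *m v); rewrite //= mulKVmx.
by rewrite e1; exists (invmx (hom1 j) *m v); rewrite //= mulKVmx.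
Qed.

Section Conjugation.
Variables (r : nat) (E E' : bundle k r) (f : bundle_hom E E') (g : bundle_hom E' E).
Variables (t : int) (Phi : bundle_hom E (twist t E)).

Fact conj_compat : hom_compat E' (twist t E')
  (hom0 f *m hom0 Phi *m hom0 g, hom1 f *m hom1 Phi *m hom1 g).
Proof.
apply/eqP; rewrite /= !map_mxM /= -mulmxA (eqP (hom_pairP g)) -scalemxAl.
rewrite [in LHS]mulmxA -[_ *m _ *m cocycle E]mulmxA hom_twistE -scalemxAr -scalemxAl.
by rewrite !mulmxA (eqP (hom_pairP f)).
Qed.

Definition conj_hom : bundle_hom E' (twist t E') := Defs.Hom conj_compat.
End Conjugation.

Section Split.
Variables (r : nat) (a : 'I_r -> int).
Local Notation S := (split_bundle k a).

(** Entry (i, j) of a morphism into the twist is a section of O(t + a_i - a_j). *)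
Lemma split_compatE t (A B : 'M[{poly k}]_r) :
  hom_compat S (twist t S) (A, B) <->
  forall i j, res1 (B i j) = zz ^ (- (t + a i - a j)) * res0 (A i j).
Proof.
have e i j : (map_mx res1 B *m S) i j = res1 (B i j) * zz ^ (- a j).
  by rewrite /= /split_mx mul_mx_diag !mxE.
have e' i j : (twist t S *m map_mx res0 A) i j = zz ^ (- t - a i) * res0 (A i j).
  rewrite /= -scalemxAl /split_mx mul_diag_mx !mxE mulrA -expfzDr ?zz_neq0 //.
split=> [/eqP h i j|h].
  have : (map_mx res1 B *m S) i j = (twist t S *m map_mx res0 A) i j by rewrite -h.
  rewrite e e' => h'; apply: (mulIf (expfz_neq0 (- a j) zz_neq0)).
  rewrite h' [RHS]mulrAC -expfzDr ?zz_neq0 //; congr (zz ^ _ * _); lia.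
apply/eqP/matrixP => i j; rewrite e e' h mulrAC -expfzDr ?zz_neq0 //.
by congr (zz ^ _ * _); lia.
Qed.

Lemma split_homE t (Psi : bundle_hom S (twist t S)) i j :
  res1 (hom1 Psi i j) = zz ^ (- (t + a i - a j)) * res0 (hom0 Psi i j).
Proof.
by apply/(split_compatE t _ _).1; rewrite -surjective_pairing (hom_pairP Psi).
Qed.
End Split.

(** * The subsheaf spanned by the first s summands *)

Section Destabilise.
Variables (r : nat) (E : bundle k r) (a : 'I_r -> int).
Local Notation S := (split_bundle k a).
Variables (f : bundle_hom E S) (g : bundle_hom S E).
Hypotheses (gf0 : hom0 g *m hom0 f = 1%:M) (gf1 : hom1 g *m hom1 f = 1%:M).
Hypotheses (fg0 : hom0 f *m hom0 g = 1%:M) (fg1 : hom1 f *m hom1 g = 1%:M).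
Variables (s : nat) (sr : (s <= r)%N).

Definition head_bundle : bundle k s := split_bundle k (fun i => a (widen_ord sr i)).

(** Cut out by the vanishing of the coordinates of index at least s in the splitting f, so it is the
    image of the first s summands. *)
Definition head_sheaf : subsheaf E :=
  ker_sheaf E (copid_mx s *m map_mx res0 (hom0 f)).

Lemma pid_head (R : pzRingType) :
  (pid_mx s : 'M[R]_(r, s)) *m (pid_mx s : 'M_(s, r)) = pid_mx s.
Proof. by rewrite mul_pid_mx !minnn. Qed.

Lemma pid_headT (R : pzRingType) :
  (pid_mx s : 'M[R]_(s, r)) *m (pid_mx s : 'M_(r, s)) = 1%:M.
Proof. by rewrite mul_pid_mx minnn (minn_idPr sr) pid_mx_1. Qed.

Lemma copid_ker (R : pzRingType) m (v : 'M[R]_(r, m)) : copid_mx s *m v = 0 ->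
  v = (pid_mx s : 'M_(r, s)) *m ((pid_mx s : 'M_(s, r)) *m v).
Proof.
by rewrite mulmxA pid_head /copid_mx mulmxBl mul1mx => /eqP; rewrite subr_eq0 => /eqP.
Qed.

Lemma copid_head (R : pzRingType) : copid_mx s *m (pid_mx s : 'M[R]_(r, s)) = 0.
Proof. by rewrite /copid_mx mulmxBl mul1mx -pid_head -mulmxA pid_headT mulmx1 subrr. Qed.

Lemma split_pid : S *m (pid_mx s : 'M_(r, s)) = pid_mx s *m head_bundle.
Proof.
apply/matrixP => i j; rewrite /= /split_mx mul_mx_diag mul_diag_mx !mxE.
case: eqP => [eij|_] /=; last by rewrite mulr0 mul0r.
rewrite eij ltn_ord mulr1 mul1r; congr (zz ^ (- a _)).
exact: val_inj.
Qed.

Lemma copid_split m (v : 'M[Kz]_(r, m)) : copid_mx s *m v = 0 ->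
  copid_mx s *m (S *m v) = 0.
Proof.
move/copid_ker => ->; rewrite (mulmxA (cocycle S)) split_pid !mulmxA copid_head.
by rewrite !mul0mx.
Qed.

Lemma copid_splitV m (v : 'M[Kz]_(r, m)) : copid_mx s *m (S *m v) = 0 ->
  copid_mx s *m v = 0.
Proof.
have uS := cocycle_unit S; have uH := cocycle_unit head_bundle => h.
have -> : v = pid_mx s *m (invmx head_bundle *m (pid_mx s *m (S *m v))).
  apply: (can_inj (mulKmx uS)); rewrite /= (mulmxA (cocycle S)) split_pid.
  rewrite -mulmxA mulKVmx //.
  exact: copid_ker.
by rewrite !mulmxA copid_head !mul0mx.
Qed.

Lemma head_sheaf_model : sub_iso head_bundle head_sheaf.
Proof.
have c : hom_compat head_bundle E (hom0 g *m pid_mx s, hom1 g *m pid_mx s).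
  apply/eqP; rewrite /= !map_mxM /= !map_pid_mx -mulmxA -split_pid [in LHS]mulmxA.
  by rewrite (eqP (hom_pairP g)) !mulmxA.
have inj (h h' : 'M[{poly k}]_r) : h *m h' = 1%:M ->
    injective (fun u : 'cV_s => h' *m pid_mx s *m u).
  move=> hh' u v /(congr1 (fun w => (pid_mx s : 'M_(s, r)) *m (h *m w))).
  by rewrite !mulmxA -!(mulmxA _ h h') hh' mulmx1 pid_headT !mul1mx.
have kerR (phi : {rmorphism {poly k} -> Kz}) (h h' : 'M[{poly k}]_r) :
    injective phi -> h *m h' = 1%:M -> h' *m h = 1%:M ->
    phi_ker phi (copid_mx s *m map_mx phi h) =
    range (fun u : 'cV_s => h' *m pid_mx s *m u).
  move=> phi_inj hh' h'h; rewrite eqEsubset; split=> [v|_ [u _ <-]].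
    rewrite /phi_ker /= -mulmxA -map_mxM => e.
    have : copid_mx s *m (h *m v) = 0.
      by apply: (map_mx_injective phi_inj); rewrite map_mxM map_copid_mx e map_mx0.
    move/copid_ker => e'; exists (pid_mx s *m (h *m v)) => //=.
    by rewrite -mulmxA -e' mulmxA h'h mul1mx.
  rewrite /phi_ker /= -(map_copid_mx phi) -!map_mxM !mulmxA -(mulmxA _ h h') hh' mulmx1.
  by rewrite copid_head mul0mx map_mx0.
exists (Defs.Hom c); split; rewrite /hom0 /hom1 /=.
- exact: inj fg0.
- exact: inj fg1.
- exact: (kerR _ _ _ (@res0_inj k) fg0 gf0).
rewrite -(kerR _ _ _ (@res1_inj k) fg1 gf1).
(* On U1 the defining matrix contains f0 E^-1, which S turns into f1. Being diagonal, S preserves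
   and reflects the vanishing of the last coordinates. *)
have eE : S *m (map_mx res0 (hom0 f) *m invmx E) = map_mx res1 (hom1 f).
  by rewrite mulmxA -(eqP (hom_pairP f)) mulmxK ?cocycle_unit.
rewrite eqEsubset; split=> v; rewrite /phi_ker /= -eE -!mulmxA.
  exact: copid_split.
exact: copid_splitV.
Qed.

Lemma head_sheaf_proper : (0 < s < r)%N -> sub_proper head_sheaf.
Proof.
case/andP => s0 lt_sr; apply: ker_sheaf_proper.
rewrite mxrankMfree; last first.
  rewrite row_free_unit; apply: (proj1 (@mulmx1_unit _ _ _ (map_mx res0 (hom0 g)) _)).
  by rewrite -map_mxM fg0 map_mx1.
by rewrite rank_copid_mx // subn_gt0 lt_sr ltn_subrL s0 (leq_trans _ lt_sr).
Qed.

(** The entries of Phi from the first s summands to the others are sections of line bundles of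
    negative degree, hence zero. *)
Lemma head_sheaf_preserved t (Phi : bundle_hom E (twist t E)) :
  (forall i j : 'I_r, (s <= i)%N -> (j < s)%N -> t + a i - a j < 0) ->
  preserved Phi head_sheaf.
Proof.
move=> hneg; apply: ker_sheaf_preserved => u.
pose A := hom0 f *m hom0 Phi *m hom0 g.
have A0 (i j : 'I_r) : (s <= i)%N -> (j < s)%N -> A i j = 0.
  move=> si js; apply/eqP/contraT => nz.
  have := section_degree (split_homE (conj_hom f g Phi) i j) nz.
  by have := hneg i j si js; lia.
have DAJ : copid_mx s *m A *m (pid_mx s : 'M_(r, s)) = 0.
  rewrite -mulmxA; apply/matrixP => i j; rewrite !mxE big1 // => l _.
  case: (ltnP l s) => [ls|sl].
    rewrite !mxE; have [->|nil] := eqVneq i l; first by rewrite eqxx ls subrr mul0r.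
    by rewrite (negPf nil : (i == l :> nat) = false) subrr mul0r.
  rewrite [X in _ * X]mxE big1 ?mulr0 // => m _; rewrite [X in _ * X]mxE.
  by case: eqP => [em|_]; [rewrite A0 ?mul0r // em | rewrite mulr0].
rewrite -mulmxA => /copid_ker; set w := map_mx res0 _ *m u => ew.
have -> : map_mx res0 (hom0 Phi) *m u =
    map_mx res0 (hom0 g *m A) *m w.
  by rewrite /w mulmxA -map_mxM /A !mulmxA gf0 mul1mx -!mulmxA gf0 mulmx1.
rewrite mulmxA -(mulmxA _ _ (map_mx res0 (hom0 g *m A))) -map_mxM mulmxA fg0 mul1mx.
rewrite ew !mulmxA -(map_copid_mx res0) -(map_pid_mx res0) -!map_mxM DAJ map_mx0.
by rewrite !mul0mx.
Qed.
End Destabilise.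

(** P and T stand for the total degrees of the first s summands and of the rest. Since P/s >= x > y
    >= T/(r - s), the slope P/s exceeds that of the whole. *)
Lemma head_slope_ineq (r s : nat) (P T x y : int) : (0 < s < r)%N -> y < x ->
  x *+ s <= P -> T <= y *+ r - y *+ s ->
  (P%:~R / s%:R : rat) <= (P + T)%:~R / r%:R -> False.
Proof.
case/andP => s0 sr yx hP hT; rewrite ler_pdivrMr ?ltr0n // mulrAC.
rewrite ler_pdivlMr ?ltr0n ?(leq_trans _ sr) //.
have natE n : (n%:R : rat) = n%:Z%:~R by [].
rewrite (natE s) (natE r) -!intrM ler_int => h; move: hP hT.
rewrite -(mulr_natr x) -(mulr_natr y r) -(mulr_natr y s) !natz => hP hT.
have [d ed] : exists d, r = (s + d.+1)%N by exists (r - s).-1; lia.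
subst r; rewrite PoszD in h hT; set S := s%:Z in hP hT h *; set D := d.+1%:Z in hT h.
have S0 : 0 < S by []; have D0 : 0 < D by [].
have hT' : T <= y * D by rewrite (le_trans hT) // mulrDr addrAC subrr add0r.
have h1 : P * D <= T * S by move: h; rewrite mulrDr mulrDl lerD2l.
have h2 : x * S * D <= y * D * S.
  rewrite (le_trans (ler_wpM2r (ltW D0) hP)) // (le_trans h1) //.
  by rewrite ler_pM2r.
by move: h2; rewrite mulrAC !ler_pM2r // leNgt yx.
Qed.

Lemma semistable_gap r (E : bundle k r) (a : 'I_r -> int) (t : int) : 0 <= t ->
  (forall i j : 'I_r, (i <= j)%N -> a j <= a i) ->
  bundle_iso E (split_bundle k a) ->
  forall Phi : bundle_hom E (twist t E), semistable Phi ->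
  forall i j : 'I_r, nat_of_ord j = i.+1 -> a i - t <= a j.
Proof.
move=> t0 ha hE Phi ss i j eji; rewrite leNgt; apply/negP => lt_a.
have [f [g [gf0 gf1 fg0 fg1]]] := hE.
(* Indices start at 0, so j = i + 1 is also the number of summands up to index i. *)
have jr : (j <= r)%N by exact: ltnW.
have s0r : (0 < j < r)%N by rewrite eji /= -eji.
have Fpr : preserved Phi (head_sheaf f j).
  apply: (head_sheaf_preserved gf0 fg0 jr) => m n jm nj.
  have : a m <= a j by apply: ha.
  have : a i <= a n by apply: ha; rewrite -ltnS -eji.
  by move: lt_a; lia.
have := ss _ (head_sheaf_proper fg0 jr s0r) Fpr.
rewrite (sub_slopeE (head_sheaf_model gf0 gf1 fg0 fg1 jr)).
rewrite /slope (degree_iso hE) !degree_split.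
set P := \sum_i _; pose T := \sum_(n < r | ~~ (n < j)%N) a n.
have -> : \sum_n a n = P + T.
  by rewrite (bigID (fun n : 'I_r => (n < j)%N)) /= (big_ord_narrow jr).
apply: (@head_slope_ineq _ _ _ _ (a i) (a j)) => //; first by move: lt_a; lia.
  have -> : a i *+ j = \sum_(n < j) a i by rewrite sumr_const card_ord.
  by apply: ler_sum => n _; apply: ha; rewrite /= -ltnS -eji.
have -> : a j *+ r - a j *+ j = \sum_(n < r | ~~ (n < j)%N) a j.
  have -> : a j *+ r = \sum_(n < r) a j by rewrite sumr_const card_ord.
  rewrite (bigID (fun n : 'I_r => (n < j)%N)) /= (big_ord_narrow jr).
  by rewrite sumr_const card_ord addrAC subrr add0r.
by apply: ler_sum => n; rewrite -leqNgt => jn; apply: ha.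
Qed.

Lemma det_exp (R : comNzRingType) n (A : 'M[R]_n) m : \det (A ^+ m) = \det A ^+ m.
Proof.
elim: m => [|m IH]; first by rewrite !expr0 det1.
by rewrite !exprS -IH -det_mulmx.
Qed.

(* The companion matrix of X^r - z. *)
Definition shift_mx r : 'M[{poly k}]_r :=
  \matrix_(i, j) if i == j.+1 :> nat then 1
                 else if (i == 0%N :> nat) && (j.+1 == r) then 'X else 0.

(** The matrix sends each basis vector to the next and the last one to z e_0, so r steps multiply
    every basis vector by z. *)
Lemma shift_mx_exp r : (0 < r)%N -> shift_mx r ^+ r = 'X%:M.
Proof.
case: r => // n _; pose e i : 'cV[{poly k}]_n.+1 := delta_mx i 0.
have shiftS (j : nat) : (j < n)%N -> shift_mx n.+1 *m e (inord j) = e (inord j.+1).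
  move=> jn; apply/colP => i; rewrite -colE !mxE inordK 1?ltnW //.
  rewrite eqSS (ltn_eqF jn) andbF eqxx andbT -val_eqE /= inordK //.
  by case: eqP.
have shift_last : shift_mx n.+1 *m e (inord n) = 'X *: e (inord 0).
  apply/colP => i; rewrite -colE !mxE inordK // eqxx andbT.
  rewrite (ltn_eqF (ltn_ord i)) eqxx andbT -val_eqE /= inordK //.
  by case: eqP; rewrite ?mulr1 ?mulr0.
have shift_iter (j m : nat) : (j + m <= n)%N ->
    shift_mx n.+1 ^+ m *m e (inord j) = e (inord (j + m)).
  elim: m => [|m IH] h; first by rewrite expr0 mul1mx addn0.
  rewrite exprS -mulmxE -mulmxA IH; last by rewrite (leq_trans _ h) // addnS.
  by rewrite addnS shiftS // -addnS.
suff he j : (j <= n)%N -> shift_mx n.+1 ^+ n.+1 *m e (inord j) = 'X *: e (inord j).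
  apply/matrixP => i j; have := he j (ltnSE (ltn_ord j)); rewrite inord_val.
  move=> /colP /(_ i); rewrite /e -colE !mxE eqxx andbT => ->.
  by rewrite mulr_natr.
(* There are n - j steps from e_j to e_n, one step to z e_0, then j steps from e_0 back to e_j. *)
move=> jn; have en : n.+1 = (j + (1 + (n - j)))%N by rewrite addnCA subnKC // add1n.
rewrite [X in _ ^+ X]en !exprD expr1 -!mulmxE -!mulmxA shift_iter ?subnKC //.
by rewrite shift_last -scalemxAr shift_iter // add0n.
Qed.

(* A restriction C of the companion matrix to rank s satisfies C^r = z, so
   det(C)^r = z^s, and r divides s. *)
Lemma shift_no_invariant r s (Q : 'M[{poly k}]_(r, s)) (C : 'M_s) :
  injective (fun u : 'cV_s => Q *m u) -> shift_mx r *m Q = Q *m C ->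
  ~~ (0 < s < r)%N.
Proof.
move=> Qinj h; apply/negP => /andP [s0 sr].
have r0 : (0 < r)%N by exact: leq_trans sr.
have : C ^+ r = 'X%:M.
  apply/eqP; rewrite -subr_eq0; apply/eqP/(mulmx_inj0 Qinj).
  rewrite mulmxBr -(exp_mulmx_comm _ h) shift_mx_exp //.
  by rewrite mul_scalar_mx mul_mx_scalar subrr.
move=> /(congr1 determinant); rewrite det_exp det_scalar.
move=> /(congr1 (fun p : {poly k} => (size p).-1)); rewrite /= size_exp size_polyXn /=.
move=> e; have : (r %| s)%N by rewrite -e dvdn_mull.
by move=> /(dvdn_leq s0); rewrite leqNgt sr.
Qed.

(** The companion matrix defines a morphism on the split bundle, then transported to E. Its entries
    1 need t + a_(i+1) - a_i >= 0, the gap hypothesis; its entry z needs t + a_1 - a_r >= 1, which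
    follows from t >= 1. *)
Lemma no_invariant_exists r (E : bundle k r) (a : 'I_r -> int) (t : int) :
  (2 <= r)%N -> 1 <= t -> (forall i j : 'I_r, (i <= j)%N -> a j <= a i) ->
  bundle_iso E (split_bundle k a) ->
  (forall i j : 'I_r, nat_of_ord j = i.+1 -> a i - t <= a j) ->
  exists Phi : bundle_hom E (twist t E), no_invariant_subbundle Phi.
Proof.
move=> r2 t1 ha [f [g [gf0 gf1 fg0 fg1]]] gap.
have /choice [B hB] : forall ij : 'I_r * 'I_r, exists q,
    res1 q = zz ^ (- (t + a ij.1 - a ij.2)) * res0 (shift_mx r ij.1 ij.2).
  move=> [i j] /=; rewrite mxE; case: eqP => [eij|_].
    by apply: section_lift; rewrite size_poly1; have := gap _ _ eij; lia.
  case: ifP => [/andP [/eqP i0 /eqP jr]|_]; last by exists 0; rewrite !rmorph0 mulr0.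
  apply: section_lift; rewrite size_polyX; have : a j <= a i by apply: ha; rewrite i0.
  by move: t1; lia.
have c : hom_compat (split_bundle k a) (twist t (split_bundle k a))
    (shift_mx r, \matrix_(i, j) B (i, j)).
  by apply/split_compatE => i j; rewrite mxE hB.
pose Psi := Defs.Hom c; exists (conj_hom g f Psi) => F sF pF hF.
have [s [N hN]] := sub_model F; have := proper_subbundle_rank sF pF hN.
have [j [inj0 _ e0 _]] := hN; have [A eA] := preserved_factor e0 hF.
apply/negP; apply: (@shift_no_invariant _ _ (hom0 f *m hom0 j) A).
  move=> u v /(congr1 (fun w => hom0 g *m w)) /=.
  by rewrite !mulmxA gf0 !mul1mx; apply: inj0.
rewrite -mulmxA -eA /= /hom0 /=; rewrite -/(hom0 f) -/(hom0 g) -/(hom0 j).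
by rewrite !mulmxA fg0 mul1mx.
Qed.
End SplitBundles.

(** * Elimination of eigenvalues *)

Section PolynomialMaps.
Variables (k : closedFieldType) (V : lmodType k) (I : finType).
Implicit Types (D : V -> (I -> k) -> {poly k}) (x y : I -> k).

Lemma polynomial_function_linear (f : V -> k) :
  (forall c u v, f (c *: u + v) = c * f u + f v) -> polynomial_function f.
Proof.
move=> hf; pose m := GRing.isLinear.Build k V k^o _ f hf.
exact: (PolyLin (HB.pack_for {linear V -> k^o} f m)).
Qed.

Lemma polynomial_function_sum (J : Type) (s : seq J) (F : J -> V -> k) :
  (forall j, polynomial_function (F j)) ->
  polynomial_function (fun v => \sum_(j <- s) F j v).
Proof.
move=> hF; elim: s => [|j s IH].
  under eq_fun do rewrite big_nil; exact: PolyCst.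
under eq_fun do rewrite big_cons; exact: PolyAdd.
Qed.

(* Polynomial maps to k[z] in a point of V and finitely many scalars. *)
Inductive pmap : (V -> (I -> k) -> {poly k}) -> Prop :=
| PmCst p : pmap (fun _ _ => p)
| PmLin (f : V -> {poly k}) : (forall c u v, f (c *: u + v) = c *: f u + f v) ->
    pmap (fun v _ => f v)
| PmVar i : pmap (fun _ x => (x i)%:P)
| PmAdd D D' : pmap D -> pmap D' -> pmap (fun v x => D v x + D' v x)
| PmMul D D' : pmap D -> pmap D' -> pmap (fun v x => D v x * D' v x).

Lemma pmap_ext D D' : (forall v x, D v x = D' v x) -> pmap D -> pmap D'.
Proof. by move=> h; have -> : D' = D by apply/funext => v; apply/funext => x. Qed.

Lemma pmap_coef D x n : pmap D -> polynomial_function (fun v => (D v x)`_n).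
Proof.
move=> hD; elim: hD n => [p|f hf|i|D1 D2 _ IH1 _ IH2|D1 D2 _ IH1 _ IH2] n.
- exact: PolyCst.
- by apply: polynomial_function_linear => c u v; rewrite hf coefD coefZ.
- exact: PolyCst.
- by under eq_fun do rewrite coefD; apply: PolyAdd.
- under eq_fun do rewrite coefM; apply: polynomial_function_sum => j.
  exact: PolyMul.
Qed.

Lemma pmap_sum (J : Type) (s : seq J) (F : J -> V -> (I -> k) -> {poly k}) :
  (forall j, pmap (F j)) -> pmap (fun v x => \sum_(j <- s) F j v x).
Proof.
move=> hF; elim: s => [|j s IH].
  by apply: pmap_ext (PmCst 0) => v x; rewrite big_nil.
by apply: pmap_ext (PmAdd (hF j) IH) => v x; rewrite big_cons.
Qed.

Lemma pmap_prod (J : Type) (s : seq J) (F : J -> V -> (I -> k) -> {poly k}) :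
  (forall j, pmap (F j)) -> pmap (fun v x => \prod_(j <- s) F j v x).
Proof.
move=> hF; elim: s => [|j s IH].
  by apply: pmap_ext (PmCst 1) => v x; rewrite big_nil.
by apply: pmap_ext (PmMul (hF j) IH) => v x; rewrite big_cons.
Qed.

Definition pmap_mx m n (A : V -> (I -> k) -> 'M[{poly k}]_(m, n)) :=
  forall a b, pmap (fun v x => A v x a b).

Lemma pmap_mx_scale m n D (A : V -> (I -> k) -> 'M_(m, n)) :
  pmap D -> pmap_mx A -> pmap_mx (fun v x => D v x *: A v x).
Proof.
move=> hD hA a b; apply: pmap_ext (PmMul hD (hA a b)) => v x.
by rewrite mxE.
Qed.

Lemma pmap_mx_sum (J : Type) (s : seq J) m n (F : J -> V -> (I -> k) -> 'M_(m, n)) :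
  (forall j, pmap_mx (F j)) -> pmap_mx (fun v x => \sum_(j <- s) F j v x).
Proof.
move=> hF a b; apply: pmap_ext (pmap_sum s (fun j => hF j a b)) => v x.
by rewrite summxE.
Qed.

Lemma pmap_mx_mul m n p (A : V -> (I -> k) -> 'M_(m, n))
    (B : V -> (I -> k) -> 'M_(n, p)) :
  pmap_mx A -> pmap_mx B -> pmap_mx (fun v x => A v x *m B v x).
Proof.
move=> hA hB a b; have h c : pmap (fun v x => A v x a c * B v x c b) by apply: PmMul.
by apply: pmap_ext (pmap_sum (index_enum _) h) => v x; rewrite mxE.
Qed.

Lemma pmap_mx_scalar n D : pmap D -> pmap_mx (fun v x => (D v x)%:M : 'M_n).
Proof.
move=> hD a b; apply: pmap_ext (PmMul hD (PmCst (a == b)%:R)) => v x.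
by rewrite mxE mulr_natr.
Qed.

Lemma pmap_mx_prod (J : Type) (s : seq J) n (F : J -> V -> (I -> k) -> 'M_n) :
  (forall j, pmap_mx (F j)) -> pmap_mx (fun v x => \prod_(j <- s) F j v x).
Proof.
move=> hF; elim: s => [|j s IH] a b.
  by apply: pmap_ext (pmap_mx_scalar (PmCst 1) a b) => v x; rewrite big_nil.
by apply: pmap_ext (pmap_mx_mul (hF j) IH a b) => v x; rewrite big_cons.
Qed.

Lemma pmap_mx_exp n (A : V -> (I -> k) -> 'M_n) m :
  pmap_mx A -> pmap_mx (fun v x => A v x ^+ m).
Proof.
move=> hA; elim: m => [|m IH] a b.
  by apply: pmap_ext (pmap_mx_scalar (PmCst 1) a b) => v x; rewrite expr0.
by apply: pmap_ext (pmap_mx_mul hA IH a b) => v x; rewrite exprS.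
Qed.

Lemma pmap_det n (A : V -> (I -> k) -> 'M_n) : pmap_mx A ->
  pmap (fun v x => \det (A v x)).
Proof.
move=> hA; apply: pmap_sum => s; apply: PmMul; first exact: PmCst.
by apply: pmap_prod => i.
Qed.

Definition upd x i (mu : k) : I -> k := fun j => if j == i then mu else x j.

(** Isolates the variable x_i. The bound N is uniform in v and x, so that evaluating P at a matrix
    is a sum with a fixed number of terms. *)
Lemma pmap_expand D i : pmap D ->
  exists (N : nat) (P : V -> (I -> k) -> {poly {poly k}}),
  [/\ forall v x, (size (P v x) <= N)%N, forall n, pmap (fun v x => (P v x)`_n) &
      forall v x mu, D v (upd x i mu) = (P v x).[mu%:P]].
Proof.
have cst (D' : V -> (I -> k) -> {poly k}) : pmap D' ->
    (forall v x mu, D' v (upd x i mu) = D' v x) ->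
    exists (N : nat) (P : V -> (I -> k) -> {poly {poly k}}),
    [/\ forall v x, (size (P v x) <= N)%N, forall n, pmap (fun v x => (P v x)`_n) &
      forall v x mu, D' v (upd x i mu) = (P v x).[mu%:P]].
  move=> hD' h; exists 1%N, (fun v x => (D' v x)%:P); split=> [v x|[|n]|v x mu].
  - exact: size_polyC_leq1.
  - by apply: pmap_ext hD' => v x; rewrite coefC.
  - by apply: pmap_ext (PmCst 0) => v x; rewrite coefC.
  - by rewrite hornerC h.
elim=> [p|f hf|j|D1 D2 _ [N1 [P1 [s1 h1 e1]]] _ [N2 [P2 [s2 h2 e2]]]
       |D1 D2 _ [N1 [P1 [s1 h1 e1]]] _ [N2 [P2 [s2 h2 e2]]]].
- by apply: (cst (fun _ _ => p)) => //; exact: PmCst.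
- by apply: (cst (fun v _ => f v)) => //; exact: (PmLin hf).
- have [->|ji] := eqVneq j i; last first.
    apply: (cst (fun _ x => (x j)%:P)) => [|v x mu]; first exact: PmVar.
    by rewrite /upd (negPf ji).
  exists 2%N, (fun _ _ => 'X); split=> [v x|n|v x mu].
  + by rewrite size_polyX.
  + exact: PmCst.
  + by rewrite hornerX /upd eqxx.
- exists (maxn N1 N2), (fun v x => P1 v x + P2 v x); split=> [v x|n|v x mu].
  + by rewrite (leq_trans (size_polyD _ _)) // geq_max !leq_max s1 s2 orbT.
  + by apply: pmap_ext (PmAdd (h1 n) (h2 n)) => v x; rewrite coefD.
  + by rewrite hornerD e1 e2.
- exists (N1 + N2)%N, (fun v x => P1 v x * P2 v x); split=> [v x|n|v x mu].
  + by rewrite (leq_trans (size_polyMleq _ _)) // (leq_trans (leq_pred _)) // leq_add.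
  + have h j : pmap (fun v x => (P1 v x)`_j * (P2 v x)`_(n - j)) by apply: PmMul.
    apply: pmap_ext (pmap_sum (index_enum 'I_n.+1) (fun j => h j)) => v x.
    by rewrite coefM.
  + by rewrite hornerM e1 e2.
Qed.

Lemma pmap_eliminate n D i (M : V -> 'M[k]_n.+1) :
  pmap_mx (fun v _ => map_mx polyC (M v)) -> pmap D ->
  exists2 D', pmap D' & forall v x, D' v x = 0 <->
    exists2 mu, root (char_poly (M v)) mu & D v (upd x i mu) = 0.
Proof.
move=> hM /(pmap_expand i) [N [P [sP hP eP]]].
(* This is det P(M v), written as a sum of N terms so that it is visibly a [pmap]. *)
exists (fun v x => \det (\sum_(j < N) (P v x)`_j *: map_mx polyC (M v) ^+ j)).
  apply: pmap_det; apply: pmap_mx_sum => j; apply: pmap_mx_scale => //.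
  exact: pmap_mx_exp.
move=> v x; rewrite -(horner_mx_sum _ (sP v x)) det_horner_mx_eq0.
by split=> -[mu hmu e]; exists mu => //; rewrite ?eP // -eP.
Qed.

Lemma pmap_eliminate_all n D (M : I -> V -> 'M[k]_n.+1) :
  (forall i, pmap_mx (fun v _ => map_mx polyC (M i v))) -> pmap D ->
  exists2 G : V -> {poly k}, (forall m, polynomial_function (fun v => (G v)`_m)) &
    forall v, G v = 0 <->
    exists2 y, (forall i, root (char_poly (M i v)) (y i)) & D v y = 0.
Proof.
move=> hM hD.
(* Variables are eliminated one at a time; those outside s keep the values given by x. *)
have elim_seq (s : seq I) : uniq s -> exists2 D', pmap D' & forall v x, D' v x = 0 <->
    exists y, [/\ forall i, i \in s -> root (char_poly (M i v)) (y i),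
      forall i, i \notin s -> y i = x i & D v y = 0].
  elim: s => [|i s IH] /= => [_|/andP [ns us]].
    exists D => // v x; split=> [e|[y [_ yx e]]]; first by exists x.
    by have <- : y = x by apply/funext => i; apply: yx.
  have [D1 hD1 e1] := IH us; have [D' hD' e'] := pmap_eliminate i (hM i) hD1.
  exists D' => // v x; rewrite e'; split=> [[mu rmu /e1 [y [hy yx e]]]|[y [hy yx e]]].
    exists y; split=> // j; rewrite inE.
      by case/orP => [/eqP ->|/hy //]; rewrite yx // /upd eqxx.
    by rewrite negb_or => /andP [ji js]; rewrite yx // /upd (negPf ji).
  exists (y i); first by apply: hy; rewrite mem_head.
  apply/e1; exists y; split=> // j js; first by apply: hy; rewrite inE js orbT.
  by rewrite /upd; case: eqVneq => [->//|ji]; apply: yx; rewrite inE negb_or ji.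
have [D' hD' e'] := elim_seq (enum I) (enum_uniq I).
(* With every variable eliminated, whether D' vanishes no longer depends on x; 0 is an arbitrary
   choice. *)
exists (fun v => D' v (fun=> 0)) => [m|v]; first exact: pmap_coef.
rewrite e'; split=> [[y [hy _ e]]|[y hy e]].
  by exists y => // i; apply: hy; rewrite mem_enum.
by exists y; split=> // i; rewrite mem_enum.
Qed.
End PolynomialMaps.

(** * Openness *)

Lemma char_poly_scale_conj (F : fieldType) n (c : F) (N A B : 'M[F]_n) i :
  N \in unitmx -> c != 0 -> (i <= n)%N -> B = c *: (N *m A *m invmx N) ->
  (char_poly B)`_i = c ^+ (n - i) * (char_poly A)`_i.
Proof. by move=> uN c0 le_in ->; rewrite char_poly_scale // char_poly_conj. Qed.

Lemma map_char_poly_coef (R S : comNzRingType) (f : {rmorphism R -> S}) n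
  (A : 'M_n) i : f (char_poly A)`_i = (char_poly (map_mx f A))`_i.
Proof. by rewrite -map_char_poly coef_map. Qed.

(** * Restriction to an invariant subsheaf and its characteristic polynomial *)

Section Spectral.
Variable k : fieldType.
Local Notation Kz := {fraction {poly k}}.
Local Notation zz := (zz k).
Local Notation res0 := (@res0 k).
Local Notation res1 := (@res1 k).
Local Notation zz_neq0 := (zz_neq0 k).
Implicit Types (r s : nat).

(** Invariance gives a matrix on each chart, and injectivity of j makes the two compatible. Having a
    global morphism is what bounds the degrees in [char_poly_degree]. *)
Lemma preserved_restrict r (E : bundle k r) t (Phi : bundle_hom E (twist t E))
    (F : subsheaf E) s (N : bundle k s) (j : bundle_hom N E) :
  injective (fun u : 'cV_s => hom1 j *m u) ->
  sub0 F = range (fun u : 'cV_s => hom0 j *m u) ->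
  sub1 F = range (fun u : 'cV_s => hom1 j *m u) -> preserved Phi F ->
  exists Psi : bundle_hom N (twist t N), hom0 Phi *m hom0 j = hom0 j *m hom0 Psi.
Proof.
move=> inj1 e0 e1 hF; have [A eA] := preserved_factor e0 hF.
have [A1 eA1] : exists A1, hom1 Phi *m hom1 j = hom1 j *m A1.
  apply: range_factor => i; rewrite -e1 colE -mulmxA -colE.
  by apply: hF.2; rewrite e1; exists (delta_mx i 0); rewrite ?colE.
have c : hom_compat N (twist t N) (A, A1).
  apply/eqP/eqP; rewrite -subr_eq0; apply/eqP.
  apply: (map_mulmx_inj0 (@res1_inj k) (@res1_frac k) inj1) => /=.
  rewrite mulmxBr -scalemxAl -scalemxAr !mulmxA -map_mxM -eA1 map_mxM.
  rewrite -(mulmxA _ _ (cocycle N)) (eqP (hom_pairP j)) mulmxA hom_twistE.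
  by rewrite -scalemxAl -!mulmxA -!map_mxM eA subrr.
by exists (Defs.Hom c).
Qed.

(** On U1 the matrix of Psi is z^-t times a conjugate of the one on U0, so the coefficient of X^i is
    a section of O(t (s - i)). *)
Lemma char_poly_degree s (N : bundle k s) (t : nat)
    (Psi : bundle_hom N (twist t%:Z N)) i :
  (size ((char_poly (hom0 Psi))`_i)%R <= (t * s).+1)%N.
Proof.
have [->|nz] := eqVneq (char_poly (hom0 Psi))`_i 0; first by rewrite size_poly0.
have le_is : (i <= s)%N.
  rewrite -ltnS -(size_char_poly (hom0 Psi)) ltnNge; apply: contra nz => h.
  by rewrite nth_default.
have uN := cocycle_unit N.
have e1 : map_mx res1 (hom1 Psi) =
    zz ^ (- t%:Z) *: (N *m map_mx res0 (hom0 Psi) *m invmx N).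
  by rewrite scalemxAl -hom_twistE mulmxK.
have e : res1 (char_poly (hom1 Psi))`_i =
    zz ^ (- (t * (s - i))%:Z) * res0 (char_poly (hom0 Psi))`_i.
  have zt0 : zz ^ (- t%:Z) != 0 by rewrite expfz_neq0 ?zz_neq0.
  have e2 := etrans (map_char_poly_coef res1 _ i) (char_poly_scale_conj uN zt0 le_is e1).
  apply: (etrans e2); congr (_ * _); last exact: esym (map_char_poly_coef res0 _ i).
  by rewrite exprnP exprz_exp PoszM mulNr.
have := section_degree e nz.
have : (0 < size ((char_poly (hom0 Psi))`_i)%R)%N by rewrite size_poly_gt0.
have aux (m : nat) : (0 < m)%N -> m.-1%:Z <= (t * (s - i))%:Z -> (m <= (t * s).+1)%N.
  have : (t * (s - i) <= t * s)%N by rewrite leq_mul2l leq_subr orbT.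
  lia.
exact: aux.
Qed.

(** For v nonzero in the kernel of b(A), the span of v, A v, ..., A^(s-1) v is invariant because b
    is monic of degree s. *)
Lemma singular_invariant_span r s (A : 'M[{poly k}]_r.+1) (b : {poly {poly k}}) :
  b \is monic -> size b = s.+1 -> (0 < s)%N ->
  \det (horner_mx A b) = 0 ->
  exists (Q : 'M[Kz]_(r.+1, s)) C,
    map_mx res0 A *m Q = Q *m C /\ (0 < \rank Q)%N.
Proof.
move=> bm sb s0 det0; set A' := map_mx res0 A; pose b' := map_poly res0 b.
have sb' : size b' = s.+1.
  by rewrite size_map_poly_id0 ?sb // (monicP bm) rmorph1 oner_neq0.
have b's : b'`_s = 1.
  by rewrite coef_map /= -[s]/(s.+1.-1) -sb -lead_coefE (monicP bm) rmorph1.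
have /eqP/det0P [v v0 vA] : \det (horner_mx A' b')^T = 0.
  by rewrite det_tr -map_horner_mx det_map_mx det0 rmorph0.
have xA : horner_mx A' b' *m v^T = 0.
  by apply: trmx_inj; rewrite trmx_mul trmxK vA trmx0.
pose Q := \matrix_(i < r.+1, j < s) (A' ^+ j *m v^T) i 0.
have colQ j : col j Q = A' ^+ j *m v^T by apply/colP => i; rewrite !mxE.
have [|C eC] := @range_factor Kz _ _ _ Q (A' *m Q); last first.
  exists Q, C; split=> //; rewrite lt0n mxrank_eq0; apply: contra v0 => /eqP Q0.
  rewrite -trmx_eq0; apply/eqP; have := colQ (Ordinal s0).
  by rewrite Q0 expr0 mul1mx => <-; apply/colP => i; rewrite !mxE.
move=> j; rewrite colE -mulmxA -colE colQ mulmxA mulmxE -exprS.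
have [js|] := ltnP j.+1 s; first
  by exists (delta_mx (Ordinal js) 0); rewrite // -colE colQ.
rewrite leq_eqVlt ltnNge ltn_ord orbF => /eqP <-.
(* The last column is sent to A^s v, which b(A) v = 0 expresses through the lower powers. *)
exists (\col_i - b'`_i) => //; apply/eqP; rewrite eq_sym -subr_eq0; apply/eqP.
rewrite -[RHS]xA (@horner_mx_sum _ _ _ _ s.+1) ?sb' // big_ord_recr /= b's scale1r.
rewrite mulmxDl addrC; congr (_ + _); rewrite mulmx_suml.
apply/colP => i; rewrite !mxE summxE -sumrN; apply: eq_bigr => l _.
by rewrite -scalemxAl !mxE mulrN opprK mulrC.
Qed.
End Spectral.

(** The nodes 0, ..., N are distinct in characteristic zero. *)
Lemma lagrange_basis (k : numClosedFieldType) N : exists L : 'I_N.+1 -> {poly k},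
  forall p : {poly k}, (size p <= N.+1)%N ->
  p = \sum_(j < N.+1) (p.[j%:R])%:P * L j.
Proof.
have inj : injective (fun i : nat => i%:R : k) by move=> i j /eqP; rewrite eqr_nat => /eqP.
exists (fun j => tnth (qpoly.lagrange N.+1 (fun i : nat => i%:R : k)) j) => p sp.
exact: qpoly.lagrange_gen (ltn0Sn N) inj _ sp.
Qed.

Section Openness.
Variables (k : numClosedFieldType) (n : nat) (E : bundle k n.+1) (t : nat).
Local Notation V := (bundle_hom E (twist t%:Z E)).
(** Bounds the degree in z of the coefficients of the characteristic polynomial of any restriction,
    whose rank is at most n + 1. *)
Local Notation N := (t * n.+1)%N.
Variable L : 'I_N.+1 -> {poly k}.
Hypothesis L_basis : forall p : {poly k}, (size p <= N.+1)%N ->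
  p = \sum_(j < N.+1) (p.[j%:R])%:P * L j.

Definition root_poly s (x : 'I_N.+1 * 'I_s -> k) j : {poly k} :=
  \prod_i ('X - (x (j, i))%:P).

(* The polynomial of degree s in X with coefficients in k[z] whose value at
   z = j has the roots x (j, i). *)
Definition interp s (x : 'I_N.+1 * 'I_s -> k) : {poly {poly k}} :=
  \sum_j (L j)%:P * map_poly polyC (root_poly x j).

Lemma size_root_poly s (x : 'I_N.+1 * 'I_s -> k) j : size (root_poly x j) = s.+1.
Proof. by rewrite size_prod_XsubC /index_enum -enumT size_enum_ord. Qed.

Lemma interp_coef s (x : 'I_N.+1 * 'I_s -> k) m :
  (interp x)`_m = \sum_j ((root_poly x j)`_m)%:P * L j.
Proof.
rewrite coef_sum; apply: eq_bigr => j _.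
by rewrite coefCM coef_map mulrC.
Qed.

(** The leading coefficient is 1 at each node, and interpolating the constant 1 gives 1. *)
Lemma interp_monic s (x : 'I_N.+1 * 'I_s -> k) :
  interp x \is monic /\ size (interp x) = s.+1.
Proof.
have cs : (interp x)`_s = 1.
  rewrite interp_coef [RHS]L_basis ?size_poly1 //; apply: eq_bigr => j _.
  rewrite hornerC; congr (_%:P * _).
  have /monicP := monic_prod_XsubC (index_enum 'I_s) xpredT (fun i => x (j, i)).
  by rewrite lead_coefE -/(root_poly x j) size_root_poly.
have sle : (size (interp x) <= s.+1)%N.
  apply/leq_sizeP => m sm; rewrite interp_coef big1 // => j _.
  by rewrite nth_default ?size_root_poly // mul0r.
have ss : size (interp x) = s.+1.
  apply/eqP; rewrite eqn_leq sle ltnNge; apply/negP => h.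
  by move: cs; rewrite nth_default // => /esym/eqP; rewrite oner_eq0.
by split=> //; rewrite monicE lead_coefE ss cs.
Qed.

(** In this form the dependence on A and x is visibly polynomial. *)
Lemma horner_mx_interp s (x : 'I_N.+1 * 'I_s -> k) (A : 'M[{poly k}]_n.+1) :
  horner_mx A (interp x) = \sum_j L j *: \prod_i (A - ((x (j, i))%:P)%:M).
Proof.
rewrite rmorph_sum; apply: eq_bigr => j _.
rewrite rmorphM /= horner_mx_C -mulmxE mul_scalar_mx; congr (_ *: _).
rewrite !rmorph_prod; apply: eq_bigr => i _.
by rewrite !rmorphB /= map_polyX map_polyC /= horner_mx_X horner_mx_C.
Qed.

Definition specialize (v : V) (c : k) : 'M[k]_n.+1 := map_mx (horner_eval c) (hom0 v).

Lemma hom0_lin c (u v : V) a b :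
  hom0 (c *: u + v) a b = c *: hom0 u a b + hom0 v a b.
Proof. by rewrite /hom0 /= !mxE mul_polyC. Qed.

(** The scalars x are confined to roots of characteristic polynomials determined by v, as
    [pmap_eliminate_all] requires. *)
Definition has_roots (v : V) s : Prop :=
  exists2 x : 'I_N.+1 * 'I_s -> k,
    (forall ji : 'I_N.+1 * 'I_s, root (char_poly (specialize v (ji.1)%:R)) (x ji)) &
    \det (horner_mx (hom0 v) (interp x)) = 0.

Lemma has_roots_closed s : exists2 G : V -> {poly k},
  (forall m, polynomial_function (fun v => (G v)`_m)) &
  forall v, G v = 0 <-> has_roots v s.
Proof.
apply: (@pmap_eliminate_all k V ('I_N.+1 * 'I_s)%type n
   (fun v x => \det (horner_mx (hom0 v) (interp x)))
   (fun (ji : 'I_N.+1 * 'I_s) v => specialize v (ji.1)%:R)).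
  move=> ji a b.
  apply: pmap_ext (PmLin _ (f := fun v : V => (hom0 v a b).[(ji.1)%:R]%:P) _).
    by move=> v x; rewrite !mxE.
  by move=> c u v; rewrite hom0_lin hornerD hornerZ polyCD polyCM mul_polyC.
apply: pmap_ext (fun v x => congr1 determinant (esym (horner_mx_interp x (hom0 v)))) _.
apply: pmap_det; apply: pmap_mx_sum => j; apply: pmap_mx_scale; first exact: PmCst.
apply: pmap_mx_prod => i a b.
apply: pmap_ext (PmAdd (PmLin _ (f := fun v : V => hom0 v a b) _)
   (PmMul (PmCst _ _ (- (a == b)%:R)) (PmVar _ (j, i)))).
  by move=> v x; rewrite !mxE mulrC mulrN mulr_natr.
by move=> c u v; apply: hom0_lin.
Qed.

Lemma has_rootsP (v : V) :
  ~ no_invariant_subbundle v <-> exists2 s, (0 < s < n.+1)%N & has_roots v s.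
Proof.
split=> [|[s /andP [s0 sn] [x _ det0]] noinv]; last first.
  have [xm sx] := interp_monic x.
  have [Q [C [eQ Q0]]] := singular_invariant_span xm sx s0 det0.
  apply: (no_invariant_span noinv eQ); rewrite Q0 /=.
  exact: leq_ltn_trans (rank_leq_col Q) sn.
move=> ninv.
have [F [sF [pF hF]]] : exists F : subsheaf E,
    subbundle F /\ sub_proper F /\ preserved v F.
  apply: contrapT => h; apply: ninv => F sF pF hF.
  by apply: h; exists F.
have [s [M hM]] := sub_model F; have sn := proper_subbundle_rank sF pF hM.
have [j [inj0 inj1 e0 e1]] := hM; exists s => //.
have [Psi ePsi] := preserved_restrict inj1 e0 e1 hF.
(* Since F is a subbundle, the left inverse Li survives evaluation at every point z = c, so the
   restriction still embeds in the fibre there. *)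
have ds : direct_summand (range (fun u : 'cV_s => hom0 j *m u)).
  by rewrite -e0; case: sF.
have [Li LiP] := summand_left_inverse inj0 ds.
case: s sn M hM j inj0 inj1 e0 e1 Psi ePsi ds Li LiP => //.
move=> s sn M hM j inj0 inj1 e0 e1 Psi ePsi ds Li LiP.
set b := char_poly (hom0 Psi).
pose bs (c : k) := char_poly (map_mx (horner_eval c) (hom0 Psi)).
have bsE c : bs c = map_poly (horner_eval c) b by rewrite /bs map_char_poly.
have /choice [rs hrs] : forall c : k, exists rs : seq k,
    size rs = s.+1 /\ bs c = \prod_(mu <- rs) ('X - mu%:P).
  move=> c; have [rs] := closed_field_poly_normal (bs c).
  rewrite (monicP (char_poly_monic _)) scale1r => e; exists rs; split=> //.
  by apply/eqP; rewrite -eqSS -(size_prod_XsubC _ id) -e size_char_poly.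
(* These are the roots of b at each node, in an arbitrary order. *)
pose x (ji : 'I_N.+1 * 'I_s.+1) := (rs (ji.1)%:R)`_(ji.2).
have xE i : root_poly x i = bs i%:R.
  have [srs ->] := hrs i%:R; rewrite (big_nth 0) srs big_mkord.
  by apply: eq_bigr.
exists x => [[i l]|].
  apply: (@root_char_restrict _ _ _ _ (map_mx (horner_eval i%:R) (hom0 j))
    (map_mx (horner_eval i%:R) (hom0 Psi)) (map_mx (horner_eval i%:R) Li)).
  - by rewrite -!map_mxM ePsi.
  - by rewrite -map_mxM LiP map_mx1.
  - rewrite -/(bs _) (hrs _).2 root_prod_XsubC mem_nth // (hrs _).1.
    exact: ltn_ord.
(* The coefficients of b have degree at most N, so Lagrange interpolation recovers b. *)
have -> : interp x = b.
  apply/polyP => m; rewrite interp_coef [RHS]L_basis.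
    by apply: eq_bigr => i _; rewrite xE bsE coef_map.
  apply: leq_trans (char_poly_degree Psi m) _; rewrite ltnS leq_mul2l.
  by rewrite [X in _ || X]ltnW ?orbT // ; case/andP: sn.
have e : horner_mx (hom0 v) b *m hom0 j = 0.
  by rewrite (horner_mx_comm _ ePsi) Cayley_Hamilton mulmx0.
(* Multiplying b(Phi) j = 0 by the adjugate of b(Phi) gives det b(Phi) j = 0, and Li cancels j. *)
have : \det (horner_mx (hom0 v) b) *: (Li *m hom0 j) = 0.
  by rewrite scalemxAr -mul_scalar_mx -mul_adj_mx -mulmxA e !mulmx0.
by rewrite LiP => /matrixP /(_ 0 0); rewrite !mxE eqxx mulr1.
Qed.

Lemma no_invariant_open_nat :
  zariski_open [set v : V | no_invariant_subbundle v]%classic.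
Proof.
have /choice [G hG] : forall s, exists G : V -> {poly k},
    (forall m, polynomial_function (fun v => (G v)`_m)) /\
    forall v, G v = 0 <-> has_roots v s.
  by move=> s; have [G h1 h2] := has_roots_closed s; exists G.
(* A finite union of closed sets: in the domain k[z] the product vanishes exactly when some factor
   does, and its coefficients are the equations. *)
pose H (ss : seq nat) v := \prod_(s <- ss | (0 < s)%N) G s v.
have HP ss m : polynomial_function (fun v => (H ss v)`_m).
  elim: ss m => [|s ss IH] m.
    by rewrite /H; under eq_fun do rewrite big_nil; exact: PolyCst.
  have -> : (fun v => (H (s :: ss) v)`_m) =
      if (0 < s)%N then fun v => (G s v * H ss v)`_m else fun v => (H ss v)`_m.
    by rewrite /H; case: ifP => s0; apply/funext => v; rewrite big_cons s0.
  case: ifP => _; last exact: IH.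
  under eq_fun do rewrite coefM; apply: polynomial_function_sum => i.
  by apply: PolyMul; [exact: (hG s).1 | exact: IH].
exists (range (fun m v => (H (iota 0 n.+1) v)`_m)).
  by move=> _ [m _ <-]; apply: HP.
apply/seteqP; split=> v /=.
  move=> /has_rootsP [s /andP [s0 sn] hs] _ [m _ <-].
  suff -> : H (iota 0 n.+1) v = 0 by rewrite coef0.
  apply/eqP; rewrite prodf_seq_eq0; apply/hasP; exists s.
    by rewrite mem_iota.
  by rewrite s0; apply/eqP/(hG s).2.
move=> h; have : H (iota 0 n.+1) v = 0.
  apply/polyP => m; rewrite coef0; apply: (h (fun v => (H (iota 0 n.+1) v)`_m)).
  by exists m.
move=> /eqP; rewrite prodf_seq_eq0 => /hasP [s]; rewrite mem_iota => /andP [_ sn].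
move=> /andP [s0 /eqP /(hG s).2 hs]; apply/has_rootsP; exists s => //.
by rewrite s0.
Qed.
End Openness.

Lemma no_invariant_open (k : numClosedFieldType) r (E : bundle k r.+1) (t : int) :
  0 <= t ->
  zariski_open [set Phi : bundle_hom E (twist t E) | no_invariant_subbundle Phi]%classic.
Proof.
case: t => // t _; have [L hL] := lagrange_basis k (t * r.+1).
exact: no_invariant_open_nat hL.
Qed.

Local Open Scope complex_scope.

(* H^0(End(E)(2 + l)) is the vector space of morphisms from E to E(2 + l); it
   is given its Zariski topology. *)
Theorem proposition5p3 (R : realType) (l : int) (hl : -1 <= l)
    (r : nat) (hr : (2 <= r)%N) (a : 'I_r -> int)
    (ha : forall i j : 'I_r, (i <= j)%N -> a j <= a i)
    (E : bundle R[i] r) (hE : bundle_iso E (split_bundle R[i] a)) :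
  (forall Phi : bundle_hom E (twist (2 + l) E), semistable Phi ->
   forall i j : 'I_r, nat_of_ord j = i.+1 -> a i - l - 2 <= a j) /\
  ((forall i j : 'I_r, nat_of_ord j = i.+1 -> a i - l - 2 <= a j) ->
   [/\ exists Phi : bundle_hom E (twist (2 + l) E),
         no_invariant_subbundle Phi /\ stable Phi,
       forall Phi : bundle_hom E (twist (2 + l) E),
         no_invariant_subbundle Phi -> stable Phi &
       zariski_open
         [set Phi : bundle_hom E (twist (2 + l) E) | no_invariant_subbundle Phi]%classic]).
Proof.
(* This is l >= -1; it leaves room for the entry z of the companion matrix. *)
have t1 : 1 <= 2 + l by lia.
have t0 : 0 <= 2 + l by exact: le_trans t1.
have shift (x : int) : x - l - 2 = x - (2 + l) by lia.
split=> [Phi ss i j eij|gap]; first by rewrite shift; apply: semistable_gap ss _ _ eij.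
split.
- have [|Phi noinv] := no_invariant_exists hr t1 ha hE.
    by move=> i j eij; rewrite -shift; apply: gap.
  by exists Phi; split=> //; apply: no_invariant_stable.
- by move=> Phi; apply: no_invariant_stable.
- case: r hr a ha E hE gap => // r _ a _ E _ _.
  exact: no_invariant_open t0.
Qed.
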